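(* Let $(M,h)$ be a closed Riemannian spin surface with local isothermal coordinates $x,y$ on an open subset, let $\lambda,\kappa\in\mathbb{R}$, and let $\psi=(\psi^1,\dots,\psi^q)\in\Gamma(\Sigma M\otimes\mathbb{R}^q)$ be a smooth solution of $$\not\partial\psi^i=\lambda\psi^i+\kappa|\psi|^2\psi^i,\qquad i=1,\dots,q.$$ Suppose moreover that for all $i,m\in\{1,\dots,q\}$, with summation over $j=1,\dots,q$, $$|P_-\psi^j|_{\Sigma M}^2\langle P_-\psi^i,P_-\psi^m\rangle_{\Sigma M}=|P_+\psi^j|_{\Sigma M}^2\langle P_+\psi^i,P_+\psi^m\rangle_{\Sigma M}.$$ Then the Noether current $J^{im}_\alpha:=\langle\psi^i,\partial_\alpha\cdot\psi^m\rangle_{\Sigma M}$, $\alpha\in\{x,y\}$, satisfies $$\partial_xJ_y^{im}-\partial_yJ_x^{im}-\kappa(J^{ij}_xJ^{jm}_y-J^{ij}_yJ^{jm}_x)=2\lambda\langle\psi^i,\partial_x\cdot\partial_y\cdot\psi^m\rangle_{\Sigma M}$$ for all $i,m$, with summation over $j$.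
   Context: $\Sigma M$ is the (complex rank 2) spinor bundle of $(M,h)$ with hermitian scalar product $\langle\cdot,\cdot\rangle_{\Sigma M}$ and metric spin connection $\nabla^{\Sigma M}$. Clifford multiplication by tangent vectors is skew-symmetric, $\langle\psi,X\cdot\eta\rangle=-\langle X\cdot\psi,\eta\rangle$, and satisfies $X\cdot Y\cdot\psi+Y\cdot X\cdot\psi=-2h(X,Y)\psi$. For an oriented local orthonormal frame $e_1,e_2$: $\not\partial=\sum_\alpha e_\alpha\cdot\nabla^{\Sigma M}_{e_\alpha}$ is the Dirac operator, $\omega_{\mathbb{C}}=i\,e_1\cdot e_2$ is the complex volume element, and $P_\pm=\frac12(1\pm\omega_{\mathbb{C}})$ are the projectors onto positive and negative spinors. $|\psi|^2=\sum_{j=1}^q|\psi^j|^2_{\Sigma M}$. *)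

(* Defs.v *)
From mathcomp Require Import all_boot all_order all_algebra.
From mathcomp Require Import all_classical all_reals all_analysis.
From mathcomp Require Export complex.

Set Implicit Arguments.
Unset Strict Implicit.
Unset Printing Implicit Defensive.

Import Order.TTheory GRing.Theory Num.Theory.
Import numFieldNormedType.Exports.

Local Open Scope classical_set_scope.
Local Open Scope ring_scope.
Local Open Scope complex_scope.

Fixpoint Cn (R : realType) (V : normedModType R) (n : nat)
    (D : set 'rV[R]_2) (f : 'rV[R]_2 -> V) : Prop :=
  match n with
  | 0 => forall x, D x -> {for x, continuous f}
  | n'.+1 => (forall x, D x -> differentiable f x) /\
             (forall k : 'I_2, Cn n' D ('D_(delta_mx 0 k) f))
  end.

Definition smooth_on (R : realType) (V : normedModType R)
    (D : set 'rV[R]_2) (f : 'rV[R]_2 -> V) : Prop :=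
  forall n, Cn n D f.

(* R[i] is not a normed module over R in the library, hence the separate
   differentiation of real and imaginary parts. *)
Definition cderive (R : realType) (v : 'rV[R]_2) (f : 'rV[R]_2 -> R[i])
    (x : 'rV[R]_2) : R[i] :=
  ('D_v (fun y => complex.Re (f y)) x) +i*
  ('D_v (fun y => complex.Im (f y)) x).

(* chart_map and chart_inv are total functions; only their restrictions to
   chart_dom and to its image are meaningful. *)
Record chart (R : realType) (M : topologicalType) : Type := Chart {
  chart_dom : set M;
  chart_map : M -> 'rV[R]_2;
  chart_inv : 'rV[R]_2 -> M }.

Definition is_chart (R : realType) (M : topologicalType) (c : chart R M)
    : Prop :=
  [/\ open (chart_dom c),
      open (chart_map c @` chart_dom c),
      forall p, chart_dom c p -> chart_inv c (chart_map c p) = p,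
      forall p, chart_dom c p -> {for p, continuous (chart_map c)} &
      forall x, (chart_map c @` chart_dom c) x ->
        {for x, continuous (chart_inv c)}].

Definition transition (R : realType) (M : topologicalType) (c c' : chart R M)
    : 'rV[R]_2 -> 'rV[R]_2 :=
  fun x => chart_map c' (chart_inv c x).

Definition overlap (R : realType) (M : topologicalType) (c c' : chart R M)
    : set 'rV[R]_2 :=
  chart_map c @` (chart_dom c `&` chart_dom c').

(* chart_at p only serves to give the tangent space at p a concrete model,
   see below. *)
Record closed_surface (R : realType) : Type := ClosedSurface {
  surface_space :> topologicalType;
  atlas : set (chart R surface_space);
  chart_at : surface_space -> chart R surface_space;
  surface_compact : compact [set: surface_space];
  surface_hausdorff : hausdorff_space surface_space;
  atlas_chart : forall c, atlas c -> is_chart c;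
  atlas_smooth : forall c c', atlas c -> atlas c' ->
    smooth_on (overlap c c') (transition c c');
  atlas_oriented : forall c c', atlas c -> atlas c' ->
    forall x, overlap c c' x -> 0 < \det (jacobian (transition c c') x);
  chart_at_atlas : forall p, atlas (chart_at p);
  chart_at_dom : forall p, chart_dom (chart_at p) p }.

(* The charts of the maximal (not necessarily oriented) smooth atlas. *)
Definition smooth_chart (R : realType) (M : closed_surface R) (c : chart R M)
    : Prop :=
  is_chart c /\
  forall c', atlas c' -> smooth_on (overlap c c') (transition c c') /\
                         smooth_on (overlap c' c) (transition c' c).

Definition smooth_fun (R : realType) (M : closed_surface R)
    (V : normedModType R) (U : set M) (f : M -> V) : Prop :=
  forall c : chart R M, atlas c ->
    smooth_on (chart_map c @` (U `&` chart_dom c))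
              (fun x => f (chart_inv c x)).

Definition smooth_cfun (R : realType) (M : closed_surface R)
    (U : set M) (f : M -> R[i]) : Prop :=
  smooth_fun U (fun p => complex.Re (f p) : R) /\
  smooth_fun U (fun p => complex.Im (f p) : R).

(* The tangent space T_p M is modelled on 'rV[R]_2, a tangent vector being
   given by its components in the chart chart_at p.  A vector field is then a
   function X : M -> 'rV[R]_2 with X p in T_p M. *)

Definition tangent_components (R : realType) (M : closed_surface R)
    (c : chart R M) (p : M) (v : 'rV[R]_2) : 'rV[R]_2 :=
  'D_v (transition (chart_at p) c) (chart_map (chart_at p) p).

(* The coordinate vector field d/dx_k of the chart c. *)
Definition coord_vector (R : realType) (M : closed_surface R)
    (c : chart R M) (k : 'I_2) (p : M) : 'rV[R]_2 :=
  'D_(delta_mx 0 k) (transition c (chart_at p)) (chart_map c p).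

Definition smooth_vector_field (R : realType) (M : closed_surface R)
    (U : set M) (X : M -> 'rV[R]_2) : Prop :=
  forall c : chart R M, atlas c ->
    smooth_on (chart_map c @` (U `&` chart_dom c))
      (fun x => tangent_components c (chart_inv c x) (X (chart_inv c x))).

Definition gram_form (R : realType) (g : 'M[R]_2) (v w : 'rV[R]_2) : R :=
  (v *m g *m w^T) 0 0.

Record metric (R : realType) (M : closed_surface R) : Type := Metric {
  gram : M -> 'M[R]_2;
  gram_sym : forall p, (gram p)^T = gram p;
  gram_pos : forall p (v : 'rV[R]_2), v != 0 -> 0 < gram_form (gram p) v v;
  gram_smooth : forall (c : chart R M) (k l : 'I_2), atlas c ->
    smooth_fun (chart_dom c)
      (fun p => gram_form (gram p) (coord_vector c k p) (coord_vector c l p)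
                : R) }.

Definition inner (R : realType) (M : closed_surface R) (h : metric M) (p : M)
    (v w : 'rV[R]_2) : R :=
  gram_form (gram h p) v w.

Definition metric_coef (R : realType) (M : closed_surface R) (h : metric M)
    (c : chart R M) (x : 'rV[R]_2) : 'M[R]_2 :=
  \matrix_(k, l) inner h (chart_inv c x) (coord_vector c k (chart_inv c x))
                                         (coord_vector c l (chart_inv c x)).

Definition metric_coef_diff (R : realType) (M : closed_surface R)
    (h : metric M) (c : chart R M) (m k l : 'I_2) (x : 'rV[R]_2) : R :=
  'D_(delta_mx 0 m) (fun y => metric_coef h c y k l : R) x.

Definition christoffel (R : realType) (M : closed_surface R) (h : metric M)
    (c : chart R M) (k i j : 'I_2) (x : 'rV[R]_2) : R :=
  2^-1 * \sum_l invmx (metric_coef h c x) k l *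
    (metric_coef_diff h c i j l x + metric_coef_diff h c j i l x
     - metric_coef_diff h c l i j x).

Definition levi_civita (R : realType) (M : closed_surface R) (h : metric M)
    (p : M) (v : 'rV[R]_2) (Y : M -> 'rV[R]_2) : 'rV[R]_2 :=
  let c := chart_at p in
  'D_v (fun x => tangent_components c (chart_inv c x) (Y (chart_inv c x)))
       (chart_map c p)
  + \row_k \sum_i \sum_j
      christoffel h c k i j (chart_map c p) * v 0 i * Y p 0 j.

(* The complex spin representation of Cl_2: gamma k squares to -1, and
   'i *: (gamma 0 *m gamma 1) is diag(1, -1). *)
Definition gamma (R : realType) (k : 'I_2) : 'M[R[i]]_2 :=
  if k == 0 then delta_mx 1 0 - delta_mx 0 1
  else 'i *: (delta_mx 0 1 + delta_mx 1 0).

(* A complex number s of modulus 1 stands for Re s + Im s e_1 e_2 in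
   Spin(2), which is contained in Cl_2. *)
Definition spin_rep (R : realType) (s : R[i]) : 'M[R[i]]_2 :=
  ((complex.Re s)%:C)%:M + (complex.Im s)%:C *: (gamma R 0 *m gamma R 1).

(* A spin structure as a cover by oriented orthonormal frames together with a
   lift to Spin(2) of the SO(2)-valued cocycle comparing them.  The covering
   Spin(2) -> SO(2) sends s to the rotation s ^+ 2; spin_lift_cover says that
   it sends spin_lift a b p to the matrix taking components in the frame b to
   components in the frame a (and forces spin_lift a b p to have modulus 1).
   As for chart_at, frame_at only serves to give concrete fibres. *)
Record spin_structure (R : realType) (M : closed_surface R) (h : metric M)
    : Type := SpinStructure {
  spin_index : Type;
  frame_dom : spin_index -> set M;
  frame : spin_index -> 'I_2 -> M -> 'rV[R]_2;
  spin_lift : spin_index -> spin_index -> M -> R[i];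
  frame_at : M -> spin_index;
  frame_dom_open : forall a, open (frame_dom a);
  frame_smooth : forall a k, smooth_vector_field (frame_dom a) (frame a k);
  frame_orthonormal : forall a p, frame_dom a p ->
    forall k l, inner h p (frame a k p) (frame a l p) = (k == l)%:R;
  frame_oriented : forall a p, frame_dom a p ->
    0 < \det (\matrix_(k < 2) frame a k p);
  spin_lift_smooth : forall a b,
    smooth_cfun (frame_dom a `&` frame_dom b) (spin_lift a b);
  spin_lift_cover : forall a b p, frame_dom a p -> frame_dom b p ->
    spin_lift a b p ^+ 2 = (inner h p (frame b 0 p) (frame a 0 p)) +i*
                           (inner h p (frame b 0 p) (frame a 1 p));
  spin_lift_cocycle : forall a b c p,
    frame_dom a p -> frame_dom b p -> frame_dom c p ->
    spin_lift a b p * spin_lift b c p = spin_lift a c p;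
  frame_at_dom : forall p, frame_dom (frame_at p) p }.

(* The spinor bundle is the bundle with fibre C^2 associated to the cocycle
   spin_rep (spin_lift a b).  Its fibre at p is modelled on 'cV[R[i]]_2, an
   element being given by its components in the trivialization frame_at p, so
   that a section is a function psi : M -> 'cV[R[i]]_2. *)

Definition spinor_in_frame (R : realType) (M : closed_surface R)
    (h : metric M) (S : spin_structure h) (a : spin_index S)
    (psi : M -> 'cV[R[i]]_2) (p : M) : 'cV[R[i]]_2 :=
  spin_rep (spin_lift a (frame_at S p) p) *m psi p.

Definition smooth_spinor (R : realType) (M : closed_surface R)
    (h : metric M) (S : spin_structure h) (psi : M -> 'cV[R[i]]_2) : Prop :=
  forall (a : spin_index S) (k : 'I_2),
    smooth_cfun (frame_dom a) (fun p => spinor_in_frame a psi p k 0).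

Definition hdot (R : realType) (z w : 'cV[R[i]]_2) : R[i] :=
  \sum_k z k 0 * conjc (w k 0).

Definition oframe (R : realType) (M : closed_surface R) (h : metric M)
    (S : spin_structure h) (k : 'I_2) (p : M) : 'rV[R]_2 :=
  frame (frame_at S p) k p.

Definition clifford (R : realType) (M : closed_surface R) (h : metric M)
    (S : spin_structure h) (p : M) (v : 'rV[R]_2) (z : 'cV[R[i]]_2)
    : 'cV[R[i]]_2 :=
  \sum_k (inner h p v (oframe S k p))%:C *: (gamma R k *m z).

(* nabla_v psi = d psi(v) + 1/2 h(nabla_v e_1, e_2) e_1 . e_2 . psi in the
   trivialization given by the frame (e_1, e_2). *)
Definition spin_connection (R : realType) (M : closed_surface R)
    (h : metric M) (S : spin_structure h) (p : M) (v : 'rV[R]_2)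
    (psi : M -> 'cV[R[i]]_2) : 'cV[R[i]]_2 :=
  let c := chart_at p in
  let a := frame_at S p in
  (\col_k cderive v (fun x => spinor_in_frame a psi (chart_inv c x) k 0)
                    (chart_map c p))
  + (2^-1 * inner h p (levi_civita h p v (frame a 0)) (frame a 1 p))%:C
      *: (gamma R 0 *m gamma R 1 *m psi p).

Definition dirac_operator (R : realType) (M : closed_surface R) (h : metric M)
    (S : spin_structure h) (psi : M -> 'cV[R[i]]_2) (p : M) : 'cV[R[i]]_2 :=
  \sum_k clifford S p (oframe S k p) (spin_connection S p (oframe S k p) psi).

Definition complex_volume (R : realType) (M : closed_surface R)
    (h : metric M) (S : spin_structure h) (p : M) (z : 'cV[R[i]]_2)
    : 'cV[R[i]]_2 :=
  'i *: clifford S p (oframe S 0 p) (clifford S p (oframe S 1 p) z).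

Definition proj_pos (R : realType) (M : closed_surface R) (h : metric M)
    (S : spin_structure h) (p : M) (z : 'cV[R[i]]_2) : 'cV[R[i]]_2 :=
  2^-1 *: (z + complex_volume S p z).

Definition proj_neg (R : realType) (M : closed_surface R) (h : metric M)
    (S : spin_structure h) (p : M) (z : 'cV[R[i]]_2) : 'cV[R[i]]_2 :=
  2^-1 *: (z - complex_volume S p z).

Definition isothermal (R : realType) (M : closed_surface R) (h : metric M)
    (c : chart R M) : Prop :=
  smooth_chart c /\
  exists rho : M -> R, forall p, chart_dom c p ->
    0 < rho p /\
    forall k l, inner h p (coord_vector c k p) (coord_vector c l p)
                = rho p * (k == l)%:R.

Definition coord_diff (R : realType) (M : closed_surface R) (c : chart R M)
    (k : 'I_2) (f : M -> R[i]) (p : M) : R[i] :=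
  cderive (delta_mx 0 k) (fun x => f (chart_inv c x)) (chart_map c p).

Definition noether_current (R : realType) (M : closed_surface R)
    (h : metric M) (S : spin_structure h) (c : chart R M) (q : nat)
    (psi : 'I_q -> M -> 'cV[R[i]]_2) (i m : 'I_q) (k : 'I_2) (p : M) : R[i] :=
  hdot (psi i p) (clifford S p (coord_vector c k p) (psi m p)).

(* Main.v *)
Require Import Defs.
From mathcomp Require Import all_boot all_order all_algebra.
From mathcomp Require Import all_classical all_reals all_analysis.
From mathcomp Require Import ring lra.

Set Implicit Arguments.
Unset Strict Implicit.
Unset Printing Implicit Defensive.

Import Order.TTheory GRing.Theory Num.Theory.
Import numFieldNormedType.Exports.

Local Open Scope classical_set_scope.
Local Open Scope ring_scope.
Local Open Scope complex_scope.

(* In the spinor trivialization of a local orthonormal frame (e_1, e_2) write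
   psi^j = (a_j, b_j) and w_k = h(d_k, e_1) + i h(d_k, e_2).  Then
   J^{im}_k = - w_k a_i conj(b_m) + conj(w_k) b_i conj(a_m), whatever the frame,
   because a lift s of a change of frame acts by w -> s^2 w, a -> conj(s) a and
   b -> s b.  When J_y is differentiated along d_x and J_x along d_y, the terms
   with derivatives of w combine, by torsion-freeness and metricity of the
   Levi-Civita connection, into the connection form that completes the
   derivatives of psi to covariant ones.  What is left is
   d_x . d_y . (Dirac psi), so that the curl of J is
   2 (lambda + kappa |psi|^2) <psi^i, d_x . d_y . psi^m>.  The commutator of the
   currents equals
   2 i det(w_x, w_y) (|b|^2 a_i conj(a_m) - |a|^2 b_i conj(b_m)),
   and the chirality hypothesis is exactly what makes it absorb the kappa
   term. *)

(** * Directional derivatives of differentiable maps *)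

Section directional_derivative.
Context {R : realType} {U V W : normedModType R}.

Lemma derive_comp (f : U -> V) (g : V -> W) (x v : U) :
  differentiable f x -> differentiable g (f x) ->
  'D_v (fun y => g (f y)) x = 'D_('D_v f x) g (f x).
Proof.
move=> df dg; have dgf := differentiable_comp df dg.
rewrite (deriveE _ dgf) (deriveE _ df) (deriveE _ dg).
by rewrite (diff_comp df dg).
Qed.

Lemma derive_dirD (f : U -> V) (x u v : U) : differentiable f x ->
  'D_(u + v) f x = 'D_u f x + 'D_v f x.
Proof. by move=> df; rewrite !deriveE// linearD. Qed.

Lemma derive_dirZ (f : U -> V) (x v : U) (a : R) : differentiable f x ->
  'D_(a *: v) f x = a *: 'D_v f x.
Proof. by move=> df; rewrite !deriveE// linearZ. Qed.

End directional_derivative.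

(** * Symmetry of second derivatives *)

Section second_derivative.
Context {R : realType} {V : normedModType R}.
Implicit Types (f : V -> R) (x y u v : V).

(** Restricting to a line turns a directional derivative into a one-variable derivative, to which
    the mean value theorem applies. *)
Lemma is_derive_line f y u (s : R) : differentiable f (s *: u + y) ->
  is_derive s 1 (fun r : R => f (r *: u + y)) ('D_u f (s *: u + y)).
Proof.
move=> df.
have dl : is_diff s (fun r : R => r *: u + y) (fun r : R => r *: u).
  have -> : (fun r : R => r *: u + y) = ( *:%R^~ u) + cst y by [].
  by apply: is_diff_eq; rewrite addr0.
have dl' : differentiable (fun r : R => r *: u + y) s by [].
have dfl := differentiable_comp dl' df.
split; first exact: diff_derivable.
apply: (etrans (derive_comp _ dl' df)); congr (derive f _ _).
by apply: (etrans (deriveE _ dl')); rewrite diff_val scale1r.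
Qed.

(** The mean value theorem is applied twice: along [u] to the increment [phi] of [f] in the
    direction [v], then along [v] to the resulting increment of [fu]. The second difference on the
    left is symmetric in [u] and [v]. *)
Lemma second_difference_MVT f fu fuv x u v (t : R) : 0 < t ->
  (forall r s : R, 0 <= r <= t -> 0 <= s <= t ->
     let y := r *: u + (s *: v + x) in
     [/\ differentiable f y, differentiable fu y,
         'D_u f y = fu y & 'D_v fu y = fuv y]) ->
  exists r s : R, [/\ 0 <= r <= t, 0 <= s <= t &
    f (t *: u + (t *: v + x)) - f (t *: u + x) - f (t *: v + x) + f x =
    fuv (r *: u + (s *: v + x)) * t * t].
Proof.
move=> t0 df.
pose phi r := f (r *: u + (t *: v + x)) - f (r *: u + x).
have tt : 0 <= t <= t by rewrite lexx ltW.
have z0 : 0 <= (0 : R) <= t by rewrite lexx ltW.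
have dphi (r : R) : 0 <= r <= t -> is_derive r 1 phi
    (fu (r *: u + (t *: v + x)) - fu (r *: u + x)).
  move=> r0t; apply: is_deriveB.
    by have [? _ <- _] := df r t r0t tt; exact: is_derive_line.
  have := df r 0 r0t z0; rewrite scale0r add0r => -[? _ <- _].
  exact: is_derive_line.
have phic : {within `[0, t], continuous phi}.
  apply: derivable_within_continuous => r; rewrite in_itv/= => /dphi h.
  exact: ex_derive.
have ooW (r : R) : r \in `]0, t[ -> 0 <= r <= t.
  by rewrite in_itv/= => /andP[? ?]; rewrite !ltW.
have [r /ooW r0t] := MVT t0 (fun r h => dphi r (ooW r h)) phic.
pose chi s := fu (s *: v + (r *: u + x)).
have dchi (s : R) : 0 <= s <= t -> is_derive s 1 chi
    (fuv (s *: v + (r *: u + x))).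
  move=> s0t; have := df r s r0t s0t; rewrite /= addrCA => -[_ ? _ <-].
  exact: is_derive_line.
have chic : {within `[0, t], continuous chi}.
  apply: derivable_within_continuous => s; rewrite in_itv/= => /dchi h.
  exact: ex_derive.
have [s /ooW s0t e2 e1] := MVT t0 (fun s h => dchi s (ooW s h)) chic.
exists r, s; split=> //.
move: e1 e2; rewrite /phi /chi !scale0r !add0r subr0.
rewrite ![s *: v + _]addrCA ![t *: v + (r *: _ + _)]addrCA.
by move=> e1 e2; rewrite -e2 -e1; ring.
Qed.

(** Each mixed derivative, at some point close to [x], equals the same second difference divided by
    [t * t]. Continuity at [x] then bounds the distance between the two values at [x] by any
    [e > 0]. *)
Lemma derive_swap f fu fv fuv fvu x u v :
  (\forall y \near x, [/\ differentiable f y, differentiable fu y,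
    'D_u f y = fu y & 'D_v fu y = fuv y]) ->
  (\forall y \near x, [/\ differentiable f y, differentiable fv y,
    'D_v f y = fv y & 'D_u fv y = fvu y]) ->
  {for x, continuous fuv} -> {for x, continuous fvu} -> fuv x = fvu x.
Proof.
move=> dfu dfv cuv cvu; apply/eqP; rewrite -subr_eq0 -normr_le0.
apply/ler_addgt0Pr => e e0; rewrite add0r.
have e20 : 0 < e / 2 by rewrite divr_gt0.
move/cvgrPdist_le : cuv => /(_ _ e20) cuv.
move/cvgrPdist_le : cvu => /(_ _ e20) cvu.
have [d /= d0 dP] := (nbhs_normP _ _).1
  (filterI (filterI dfu dfv) (filterI cuv cvu)).
(* With this choice [t * N = d / 2 < d], so the parallelogram with vertex [x] and sides [t *: u],
   [t *: v] lies in the ball; the [+ 1] keeps [N] positive when [u] and [v] vanish. *)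
pose N := `|u| + `|v| + 1.
have N0 : 0 < N by rewrite ltr_wpDl// addr_ge0.
pose t := d / 2 / N.
have t0 : 0 < t by rewrite !divr_gt0.
have inball (r s : R) : 0 <= r <= t -> 0 <= s <= t ->
    ball_ Num.norm x d (r *: u + (s *: v + x)).
  move=> /andP[r0 rt] /andP[s0 st].
  rewrite /ball_/= addrA opprD addrCA subrr addr0 normrN.
  apply: (@le_lt_trans _ _ (t * N)).
    apply: (le_trans (ler_normD _ _)).
    rewrite !normrZ !ger0_norm// /N !mulrDr mulr1.
    rewrite -addrA lerD ?ler_wpM2r// ler_wpDr ?(ltW t0)//.
    by rewrite ler_wpM2r.
  by rewrite /t divfK ?gt_eqF// ltr_pdivrMr// ltr_pMr// ltr1n.
have [|r1 [s1 [hr1 hs1 E1]]] := @second_difference_MVT f fu fuv x u v t t0.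
  by move=> r s hr hs; have [[]] := dP _ (inball r s hr hs).
have [|s2 [r2 [hs2 hr2 E2]]] := @second_difference_MVT f fv fvu x v u t t0.
  by move=> r s hr hs; have := inball s r hs hr; rewrite addrCA => /dP[[]].
have E : fuv (r1 *: u + (s1 *: v + x)) = fvu (r2 *: u + (s2 *: v + x)).
  apply: (mulIf (lt0r_neq0 t0)); apply: (mulIf (lt0r_neq0 t0)).
  rewrite [r2 *: _ + _]addrCA; apply: (etrans (esym E1)).
  apply: etrans E2; rewrite [t *: v + (t *: u + _)]addrCA.
  by congr (_ + _); exact: addrAC.
have [_ [/= B1 _]] := dP _ (inball r1 s1 hr1 hs1).
have [_ [/= _ B2]] := dP _ (inball r2 s2 hr2 hs2).
rewrite -E distrC in B2.
rewrite [leRHS]splitr -(subrKA (fuv (r1 *: u + (s1 *: v + x)))).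
by rewrite (le_trans (ler_normD _ _))// lerD.
Qed.

End second_derivative.

(** * Smooth maps and charts *)

Section smooth_functions.
Context {R : realType}.

Lemma smooth_on_differentiable (V : normedModType R) (D : set 'rV[R]_2)
    (f : 'rV[R]_2 -> V) x : smooth_on D f -> D x -> differentiable f x.
Proof. by move=> /(_ 1)[df _] /df. Qed.

Lemma smooth_on_derive (V : normedModType R) (D : set 'rV[R]_2)
    (f : 'rV[R]_2 -> V) k : smooth_on D f ->
  smooth_on D ('D_(delta_mx 0 k) f).
Proof. by move=> sf n; have [_] := sf n.+1; apply. Qed.

Lemma differentiable_entry (V : normedModType R) m n (f : V -> 'M[R]_(m, n))
    x i j : differentiable f x -> differentiable (fun y => f y i j : R) x.
Proof.
by move=> df; exact: (differentiable_comp df (differentiable_coord (f x) i j)).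
Qed.

Lemma derive_entry (V : normedModType R) m n (f : V -> 'M[R]_(m, n))
    x v i j : differentiable f x ->
  'D_v (fun y => f y i j : R) x = ('D_v f x) i j.
Proof. by move=> df; rewrite derive_mx ?mxE//; exact: diff_derivable. Qed.

Lemma smooth_on_derive_swap (D : set 'rV[R]_2) n (f : 'rV[R]_2 -> 'rV[R]_n)
    x k l : open D -> D x -> smooth_on D f ->
  'D_(delta_mx 0 k) ('D_(delta_mx 0 l) f) x =
  'D_(delta_mx 0 l) ('D_(delta_mx 0 k) f) x.
Proof.
move=> oD Dx sf; apply/rowP => j.
have near_entry (e e' : 'I_2) : \forall y \near x,
    [/\ differentiable (fun z => f z 0 j : R) y,
        differentiable (fun z => 'D_(delta_mx 0 e) f z 0 j : R) y,
        'D_(delta_mx 0 e) (fun z => f z 0 j : R) y = 'D_(delta_mx 0 e) f y 0 j &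
        'D_(delta_mx 0 e') (fun z => 'D_(delta_mx 0 e) f z 0 j : R) y =
        'D_(delta_mx 0 e') ('D_(delta_mx 0 e) f) y 0 j].
  apply: filterS (open_nbhs_nbhs (conj oD Dx)) => y Dy.
  have df := smooth_on_differentiable sf Dy.
  have ddf := smooth_on_differentiable (smooth_on_derive e sf) Dy.
  split; [exact: differentiable_entry|exact: differentiable_entry| |];
  exact: derive_entry.
apply: (derive_swap (near_entry l k) (near_entry k l)).
- apply/differentiable_continuous/differentiable_entry.
  exact: (smooth_on_differentiable
    (smooth_on_derive _ (smooth_on_derive _ sf)) Dx).
- apply/differentiable_continuous/differentiable_entry.
  exact: (smooth_on_differentiable
    (smooth_on_derive _ (smooth_on_derive _ sf)) Dx).
Qed.

End smooth_functions.

Section charts.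
Context {R : realType} {M : closed_surface R}.
Implicit Types (c : chart R M) (p : M) (v : 'rV[R]_2).

(** Continuity of the inverse chart at the image point transports open sets around [p] to
    coordinates; local identities between functions read in a chart are proved on this
    neighbourhood. *)
Lemma chart_near c p (U : set M) : is_chart c -> chart_dom c p ->
  open U -> U p ->
  \forall x \near chart_map c p, [/\ chart_dom c (chart_inv c x),
    chart_map c (chart_inv c x) = x & U (chart_inv c x)].
Proof.
move=> [_ oi ci _ cont] cp oU Up.
have ip : (chart_map c @` chart_dom c) (chart_map c p) by exists p.
have cU : \forall x \near chart_map c p, U (chart_inv c x).
  by apply: (cont _ ip); rewrite ci//; apply: open_nbhs_nbhs; split.
apply: filterS2 (open_nbhs_nbhs (conj oi ip)) cU => x [p' cp' <-].
by rewrite ci.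
Qed.

Lemma image_open c (U : set M) : is_chart c -> open U ->
  open (chart_map c @` (U `&` chart_dom c)).
Proof.
move=> cc oU; rewrite openE => _ [p [Up cp] <-].
apply: filterS (chart_near cc cp oU Up) => x [? cx ?].
by exists (chart_inv c x).
Qed.

Lemma overlap_open c c' : is_chart c -> is_chart c' -> open (overlap c c').
Proof.
by move=> cc [oc _ _ _ _]; rewrite /overlap setIC; exact: image_open.
Qed.

(** Common form of [tangent_components] (transition from [chart_at p]) and [coord_vector]
    (transition to [chart_at p]), so that one chain rule serves both. *)
Definition tangent_map c c' p v : 'rV[R]_2 :=
  'D_v (transition c c') (chart_map c p).

Lemma transition_differentiable c c' p :
  smooth_on (overlap c c') (transition c c') ->
  chart_dom c p -> chart_dom c' p ->
  differentiable (transition c c') (chart_map c p).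
Proof. by move=> s cp cp'; apply: smooth_on_differentiable s _; exists p. Qed.

Lemma transition_comp_near c1 c2 c3 p : is_chart c1 -> is_chart c2 ->
  chart_dom c1 p -> chart_dom c2 p ->
  \forall x \near chart_map c1 p,
    transition c2 c3 (transition c1 c2 x) = transition c1 c3 x.
Proof.
move=> c1c [oc2 _ c2i _ _] c1p c2p.
apply: filterS (chart_near c1c c1p oc2 c2p) => x [_ _ c2x].
by rewrite /transition c2i.
Qed.

(** Chain rule. The transitions compose only near the point, where the middle chart is defined, and
    this suffices for derivatives. *)
Lemma tangent_map_comp c1 c2 c3 p v : is_chart c1 -> is_chart c2 ->
  smooth_on (overlap c1 c2) (transition c1 c2) ->
  smooth_on (overlap c2 c3) (transition c2 c3) ->
  chart_dom c1 p -> chart_dom c2 p -> chart_dom c3 p ->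
  tangent_map c2 c3 p (tangent_map c1 c2 p v) = tangent_map c1 c3 p v.
Proof.
move=> c1c c2c s12 s23 c1p c2p c3p.
have t12 : transition c1 c2 (chart_map c1 p) = chart_map c2 p.
  by rewrite /transition; have [_ _ -> //] := c1c.
rewrite /tangent_map -[X in derive (transition c2 c3) X _]t12.
rewrite -derive_comp; last 2 first.
- exact: transition_differentiable.
- by rewrite t12; exact: transition_differentiable.
by apply: near_eq_derive; exact: transition_comp_near.
Qed.

Lemma tangent_map_id c p v : is_chart c -> chart_dom c p ->
  tangent_map c c p v = v.
Proof.
move=> cc cp; rewrite /tangent_map -[RHS](derive_id (chart_map c p) v).
apply: near_eq_derive.
by apply: filterS (chart_near cc cp (@openT _) I) => x [].
Qed.

Lemma tangent_map_sum c c' p v : smooth_on (overlap c c') (transition c c') ->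
  chart_dom c p -> chart_dom c' p ->
  tangent_map c c' p v = \sum_k v 0 k *: tangent_map c c' p (delta_mx 0 k).
Proof.
move=> s cp cp'; have d := transition_differentiable s cp cp'.
rewrite /tangent_map [in LHS](row_sum_delta v) deriveE// linear_sum.
by apply: eq_bigr => k _; rewrite deriveE// linearZ.
Qed.

Lemma chart_at_chart p : is_chart (chart_at p).
Proof. exact/atlas_chart/chart_at_atlas. Qed.

Lemma coord_vector_chart_at k p : coord_vector (chart_at p) k p = delta_mx 0 k.
Proof. exact: tangent_map_id (chart_at_chart p) (chart_at_dom p). Qed.

Lemma tangent_components_chart_at p v : tangent_components (chart_at p) p v = v.
Proof. exact: tangent_map_id (chart_at_chart p) (chart_at_dom p). Qed.

(** The model of the tangent space varies with the point through [chart_at], without any continuity.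
    The chain rule removes this dependence: in a fixed chart [c0] only the transition from [c] to
    [c0] is left. *)
Lemma tangent_components_coord_vector c0 c k p : atlas c0 -> smooth_chart c ->
  chart_dom c0 p -> chart_dom c p ->
  tangent_components c0 p (coord_vector c k p) =
  tangent_map c c0 p (delta_mx 0 k).
Proof.
move=> a0 [cc sc] c0p cp.
apply: tangent_map_comp => //; try exact: chart_at_chart.
- exact: (sc _ (chart_at_atlas p)).1.
- by apply: atlas_smooth => //; exact: chart_at_atlas.
- exact: chart_at_dom.
Qed.

Lemma tangent_components_sum c p v : atlas c -> chart_dom c p ->
  v = \sum_k tangent_components c p v 0 k *: coord_vector c k p.
Proof.
move=> ac cp.
have sa : forall c' c'', atlas c' -> atlas c'' ->
  smooth_on (overlap c' c'') (transition c' c'') by exact: atlas_smooth.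
rewrite -tangent_map_sum//; last 2 first.
- exact/sa/chart_at_atlas.
- exact: chart_at_dom.
rewrite [RHS]tangent_map_comp//.
- by rewrite tangent_map_id//; [exact: chart_at_chart|exact: chart_at_dom].
- exact: chart_at_chart.
- exact: atlas_chart.
- exact/sa/ac/chart_at_atlas.
- exact/sa/chart_at_atlas.
- exact: chart_at_dom.
- exact: chart_at_dom.
Qed.

End charts.

Lemma sum_ord2 (V : nmodType) (F : 'I_2 -> V) : \sum_k F k = F 0 + F 1.
Proof. by rewrite big_ord_recl big_ord1; congr (_ + F _); exact: val_inj. Qed.

(** * Product rules for functions and for Gram forms *)

Section pointwise_derivative.
Context {R : realType} {V : normedModType R}.
Implicit Types (f g : V -> R) (x v : V) (df dg : R).

Lemma is_derive_addf f g x v df dg : is_derive x v f df ->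
  is_derive x v g dg -> is_derive x v (fun y => f y + g y) (df + dg).
Proof. by move=> *; exact: is_deriveD. Qed.

Lemma is_derive_mulf f g x v df dg : is_derive x v f df ->
  is_derive x v g dg ->
  is_derive x v (fun y => f y * g y) (df * g x + f x * dg).
Proof.
move=> hf hg; rewrite addrC [df * _]mulrC.
exact: (is_deriveM (df := df) (dg := dg)).
Qed.

Lemma differentiable_addf f g x : differentiable f x ->
  differentiable g x -> differentiable (fun y => f y + g y) x.
Proof. by move=> *; exact: differentiableD. Qed.

Lemma differentiable_mulf f g x : differentiable f x ->
  differentiable g x -> differentiable (fun y => f y * g y) x.
Proof. by move=> *; exact: differentiableM. Qed.

Lemma differentiable_is_derive f x v : differentiable f x ->
  is_derive x v f ('D_v f x).
Proof. by move=> df; apply/derivableP/diff_derivable. Qed.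

End pointwise_derivative.

Section gram_form.
Context {R : realType}.
Implicit Types (g : 'M[R]_2) (u v w : 'rV[R]_2).

Lemma gram_formE g v w : gram_form g v w =
  v 0 0 * g 0 0 * w 0 0 + v 0 0 * g 0 1 * w 0 1 +
  v 0 1 * g 1 0 * w 0 0 + v 0 1 * g 1 1 * w 0 1.
Proof. by rewrite /gram_form !mxE !sum_ord2 !mxE !sum_ord2; ring. Qed.

Lemma gram_form_sym g v w : g^T = g -> gram_form g v w = gram_form g w v.
Proof.
move=> gs; have g10 : g 1 0 = g 0 1 by rewrite -[in RHS]gs mxE.
by rewrite !gram_formE g10; ring.
Qed.

Lemma gram_form_unit g : (forall v, v != 0 -> 0 < gram_form g v v) ->
  g \in unitmx.
Proof.
move=> gpos; rewrite unitmxE unitfE; apply/negP => /det0P[v v0 vg].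
by have := gpos v v0; rewrite /gram_form vg mul0mx mxE ltxx.
Qed.

(** The inverse matrix that raises the index of the Christoffel symbols cancels against [g], leaving
    the symbols of the first kind. The row is rewritten as [invmx g] applied to a column [Y], so
    that associativity does the cancelling. *)
Lemma gram_form_invmx g u v w (X : 'I_2 -> 'I_2 -> 'I_2 -> R) :
  g \in unitmx ->
  gram_form g u (\row_k \sum_i \sum_j
    (2^-1 * \sum_l invmx g k l * X i j l) * v 0 i * w 0 j) =
  2^-1 * \sum_l \sum_i \sum_j u 0 l * v 0 i * w 0 j * X i j l.
Proof.
move=> gu.
pose Y : 'cV[R]_2 := \col_l \sum_i \sum_j 2^-1 * v 0 i * w 0 j * X i j l.
have -> : \row_k \sum_i \sum_j
    (2^-1 * \sum_l invmx g k l * X i j l) * v 0 i * w 0 j = (invmx g *m Y)^T.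
  by apply/rowP => k; rewrite !mxE !sum_ord2 !mxE !sum_ord2; ring.
rewrite /gram_form trmxK mulmxA mulmxK//.
by rewrite !mxE !sum_ord2 !mxE !sum_ord2; ring.
Qed.

Lemma gram_form_derive (V : normedModType R) (G : V -> 'M[R]_2)
    (A B : V -> 'rV[R]_2) x e :
  (forall k l, differentiable (fun y => G y k l : R) x) ->
  differentiable A x -> differentiable B x ->
  is_derive x e (fun y => gram_form (G y) (A y) (B y) : R)
    (gram_form (\matrix_(k, l) 'D_e (fun y => G y k l : R) x) (A x) (B x) +
     gram_form (G x) ('D_e A x) (B x) + gram_form (G x) (A x) ('D_e B x)).
Proof.
move=> dG dA dB.
have term k l : is_derive x e (fun y => A y 0 k * G y k l * B y 0 l)
   (('D_e A x 0 k * G x k l + A x 0 k * 'D_e (fun y => G y k l : R) x) * B x 0 l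
    + A x 0 k * G x k l * 'D_e B x 0 l).
  apply: is_derive_mulf; first apply: is_derive_mulf.
  - rewrite -derive_entry//.
    exact/differentiable_is_derive/differentiable_entry.
  - exact: differentiable_is_derive.
  - rewrite -derive_entry//.
    exact/differentiable_is_derive/differentiable_entry.
have -> : (fun y => gram_form (G y) (A y) (B y) : R) = (fun y =>
  A y 0 0 * G y 0 0 * B y 0 0 + A y 0 0 * G y 0 1 * B y 0 1 +
  A y 0 1 * G y 1 0 * B y 0 0 + A y 0 1 * G y 1 1 * B y 0 1).
  by apply/funext => y; rewrite gram_formE.
apply: (is_derive_eq (is_derive_addf (is_derive_addf
  (is_derive_addf (term 0 0) (term 0 1)) (term 1 0)) (term 1 1))).
rewrite !gram_formE !mxE.
move: ('D_e A x) ('D_e B x) => dAe dBe.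
move: (fun k l => 'D_e (fun y => G y k l : R) x) => dGe /=.
by ring.
Qed.

Lemma gram_form_differentiable (V : normedModType R) (G : V -> 'M[R]_2)
    (A B : V -> 'rV[R]_2) x :
  (forall k l, differentiable (fun y => G y k l : R) x) ->
  differentiable A x -> differentiable B x ->
  differentiable (fun y => gram_form (G y) (A y) (B y) : R) x.
Proof.
move=> dG dA dB.
have -> : (fun y => gram_form (G y) (A y) (B y) : R) = (fun y =>
  A y 0 0 * G y 0 0 * B y 0 0 + A y 0 0 * G y 0 1 * B y 0 1 +
  A y 0 1 * G y 1 0 * B y 0 0 + A y 0 1 * G y 1 1 * B y 0 1).
  by apply/funext => y; rewrite gram_formE.
have term k l : differentiable (fun y => A y 0 k * G y k l * B y 0 l) x.
  apply: differentiable_mulf; last exact: differentiable_entry.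
  by apply: differentiable_mulf; first exact: differentiable_entry.
exact: (differentiable_addf (differentiable_addf
  (differentiable_addf (term 0 0) (term 0 1)) (term 1 0)) (term 1 1)).
Qed.

End gram_form.

(** * The metric in coordinates *)

Section metric_in_chart.
Context {R : realType} {M : closed_surface R} (h : metric M).
Implicit Types (c : chart R M) (p : M) (u v w : 'rV[R]_2).

Lemma inner_sym p v w : inner h p v w = inner h p w v.
Proof. exact/gram_form_sym/gram_sym. Qed.

Lemma inner_sum p (a b : 'rV[R]_2) (X : 'I_2 -> 'rV[R]_2) :
  inner h p (\sum_k a 0 k *: X k) (\sum_k b 0 k *: X k) =
  gram_form (\matrix_(k, l) inner h p (X k) (X l)) a b.
Proof. by rewrite !sum_ord2 /inner !gram_formE !mxE !gram_formE; ring. Qed.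

Lemma inner_metric_coef c p v w : atlas c -> chart_dom c p ->
  inner h p v w = gram_form (metric_coef h c (chart_map c p))
    (tangent_components c p v) (tangent_components c p w).
Proof.
move=> ac cp; have [_ _ ci _ _] := atlas_chart ac.
have -> : metric_coef h c (chart_map c p) =
    \matrix_(k, l) inner h p (coord_vector c k p) (coord_vector c l p).
  by apply/matrixP => k l; rewrite !mxE ci.
rewrite -[RHS](inner_sum p _ _ (fun k => coord_vector c k p)).
by rewrite -(tangent_components_sum v ac cp) -(tangent_components_sum w ac cp).
Qed.

Lemma metric_coef_differentiable c p k l : atlas c -> chart_dom c p ->
  differentiable (fun y => metric_coef h c y k l : R) (chart_map c p).
Proof.
move=> ac cp.
have -> : (fun y => metric_coef h c y k l : R) = (fun y =>
   gram_form (gram h (chart_inv c y)) (coord_vector c k (chart_inv c y))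
     (coord_vector c l (chart_inv c y))).
  by apply/funext => y; rewrite mxE.
apply: (smooth_on_differentiable (gram_smooth h k l ac ac)).
by exists p.
Qed.

Lemma metric_coef_diff_sym c m k l x :
  metric_coef_diff h c m k l x = metric_coef_diff h c m l k x.
Proof.
rewrite /metric_coef_diff; congr (derive _ _ _); apply/funext => y.
by rewrite !mxE inner_sym.
Qed.

Lemma metric_coef_chart_at p :
  metric_coef h (chart_at p) (chart_map (chart_at p) p) = gram h p.
Proof.
have [_ _ ci _ _] := chart_at_chart p.
apply/matrixP => k l; rewrite mxE ci; last exact: chart_at_dom.
rewrite !coord_vector_chart_at /inner gram_formE !mxE.
by move: k l; do 2 case=> -[|[|//]] ?;
  rewrite /= ?(mulr0, mul0r, mulr1, mul1r, addr0, add0r);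
  congr (gram h p _ _); exact: val_inj.
Qed.

End metric_in_chart.

(** * The Levi-Civita connection at a point *)

Section lowered_christoffel.
Context {R : realType} (dg : 'I_2 -> 'I_2 -> 'I_2 -> R).
Context (dg_sym : forall m k l, dg m k l = dg m l k).
Implicit Types u v w : 'rV[R]_2.

(** The Christoffel symbols of the first kind contracted with three vectors: [u] is paired with the
    result, [v] is the direction of differentiation and [w] the differentiated vector. [dg m k l]
    stands for the derivative along [m] of the metric coefficient [k l]. *)
Definition lowered_christoffel u v w : R := 2^-1 * \sum_l \sum_i \sum_j
  u 0 l * v 0 i * w 0 j * (dg i j l + dg j i l - dg l i j).

Definition dir_diff v : 'M[R]_2 :=
  \matrix_(k, l) (v 0 0 * dg 0 k l + v 0 1 * dg 1 k l).

(** The algebra behind metricity: exchanging [u] and [w] reverses the sign of the last two terms of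
    the symbol and doubles the first. *)
Lemma lowered_christoffel_compat u v w :
  lowered_christoffel u v w + lowered_christoffel w v u =
  gram_form (dir_diff v) u w.
Proof.
rewrite /lowered_christoffel gram_formE !mxE !sum_ord2 !(dg_sym _ 1 0).
by field.
Qed.

(** The algebra behind torsion-freeness, in the form that suits a pairing with coordinate fields:
    antisymmetrizing in [u] and [v] cancels the derivative along [w]. *)
Lemma lowered_christoffel_torsion u v w :
  lowered_christoffel u v w - lowered_christoffel v u w =
  gram_form (dir_diff v) u w - gram_form (dir_diff u) v w.
Proof.
rewrite /lowered_christoffel !gram_formE !mxE !sum_ord2 !(dg_sym _ 1 0).
by field.
Qed.

End lowered_christoffel.

Section levi_civita.
Context {R : realType} {M : closed_surface R} (h : metric M).
Implicit Types (c : chart R M) (p : M) (u v w : 'rV[R]_2).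

(** The field is read in the chart chosen at [p], kept fixed while the point moves; this is the map
    that [levi_civita h p] differentiates. *)
Definition components_near p (Y : M -> 'rV[R]_2) (x : 'rV[R]_2) : 'rV[R]_2 :=
  tangent_components (chart_at p) (chart_inv (chart_at p) x)
    (Y (chart_inv (chart_at p) x)).

Definition chart_point p : 'rV[R]_2 := chart_map (chart_at p) p.

Lemma chart_inv_point p : chart_inv (chart_at p) (chart_point p) = p.
Proof. by have [_ _ -> //] := chart_at_chart p; exact: chart_at_dom. Qed.

Lemma components_near_point p Y : components_near p Y (chart_point p) = Y p.
Proof.
by rewrite /components_near chart_inv_point tangent_components_chart_at.
Qed.

Definition metric_diff p (m k l : 'I_2) : R :=
  metric_coef_diff h (chart_at p) m k l (chart_point p).

Lemma metric_diff_sym p m k l : metric_diff p m k l = metric_diff p m l k.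
Proof. exact: metric_coef_diff_sym. Qed.

Lemma gram_unit p : gram h p \in unitmx.
Proof. exact/gram_form_unit/gram_pos. Qed.

Lemma inner_levi_civita p u v Y :
  inner h p u (levi_civita h p v Y) =
  gram_form (gram h p) u ('D_v (components_near p Y) (chart_point p)) +
  lowered_christoffel (metric_diff p) u v (Y p).
Proof.
have gD (g : 'M[R]_2) a b d :
    gram_form g a (b + d) = gram_form g a b + gram_form g a d.
  by rewrite !gram_formE !mxE; ring.
rewrite /inner /levi_civita gD; congr (_ + _).
rewrite /christoffel metric_coef_chart_at.
exact: (@gram_form_invmx _ _ _ _ _ (fun i j l => metric_diff p i j l +
  metric_diff p j i l - metric_diff p l i j) (gram_unit p)).
Qed.

Lemma metric_coef_differentiable_point p k l :
  differentiable (fun y => metric_coef h (chart_at p) y k l : R) (chart_point p).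
Proof.
exact: (metric_coef_differentiable h k l (chart_at_atlas p) (chart_at_dom p)).
Qed.

Lemma metric_coef_dir_diff p v :
  \matrix_(k, l)
    'D_v (fun y => metric_coef h (chart_at p) y k l : R) (chart_point p) =
  dir_diff (metric_diff p) v.
Proof.
apply/matrixP => k l; rewrite !mxE.
have d := metric_coef_differentiable_point p k l.
rewrite [in LHS](row_sum_delta v) sum_ord2.
by rewrite derive_dirD// !derive_dirZ.
Qed.

Lemma inner_derive p v (A B : 'rV[R]_2 -> 'rV[R]_2) :
  differentiable A (chart_point p) -> differentiable B (chart_point p) ->
  'D_v (fun y => gram_form (metric_coef h (chart_at p) y) (A y) (B y) : R)
    (chart_point p) =
  gram_form (dir_diff (metric_diff p) v) (A (chart_point p)) (B (chart_point p)) +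
  gram_form (gram h p) ('D_v A (chart_point p)) (B (chart_point p)) +
  gram_form (gram h p) (A (chart_point p)) ('D_v B (chart_point p)).
Proof.
move=> dA dB; rewrite -metric_coef_dir_diff -metric_coef_chart_at.
by have [_ ->] := gram_form_derive v (metric_coef_differentiable_point p) dA dB.
Qed.

(** The Christoffel terms of [Y] and [Z] add up to the derivative of the Gram matrix, the first of
    the three terms of the product rule. *)
Lemma levi_civita_metric p v Y Z :
  differentiable (components_near p Y) (chart_point p) ->
  differentiable (components_near p Z) (chart_point p) ->
  'D_v (fun y => gram_form (metric_coef h (chart_at p) y)
                   (components_near p Y y) (components_near p Z y) : R)
    (chart_point p) =
  inner h p (levi_civita h p v Y) (Z p) + inner h p (Y p) (levi_civita h p v Z).
Proof.
move=> dY dZ; rewrite inner_derive// !components_near_point.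
rewrite [X in X + inner _ _ _ _]inner_sym !inner_levi_civita.
rewrite -(lowered_christoffel_compat (metric_diff_sym p)).
rewrite (gram_form_sym _ (Z p)) ?gram_sym//.
move: (gram_form _ _ _) (gram_form _ _ _) (lowered_christoffel _ _ _ _).
by move=> a b k1; move: (lowered_christoffel _ _ _ _) => k2; ring.
Qed.

Lemma coord_vector_near c k p : smooth_chart c -> chart_dom c p ->
  \forall x \near chart_point p, components_near p (coord_vector c k) x =
    'D_(delta_mx 0 k) (transition c (chart_at p)) (transition (chart_at p) c x).
Proof.
move=> sc cp; have [oc _ _ _ _] := sc.1.
apply: filterS (chart_near (chart_at_chart p) (chart_at_dom p) oc cp).
move=> x [c0x _ cx].
exact: tangent_components_coord_vector (chart_at_atlas p) sc c0x cx.
Qed.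

Lemma transition_point c p :
  transition (chart_at p) c (chart_point p) = chart_map c p.
Proof. by rewrite /transition chart_inv_point. Qed.

Lemma coord_vector_differentiable c k p : smooth_chart c -> chart_dom c p ->
  differentiable (fun x => 'D_(delta_mx 0 k) (transition c (chart_at p))
    (transition (chart_at p) c x)) (chart_point p).
Proof.
move=> [cc sc] cp; have [s1 s2] := sc _ (chart_at_atlas p).
have d2 : differentiable ('D_(delta_mx 0 k) (transition c (chart_at p)))
    (transition (chart_at p) c (chart_point p)).
  rewrite transition_point.
  apply: smooth_on_differentiable (smooth_on_derive _ s1) _.
  by exists p => //; split=> //; exact: chart_at_dom.
exact: (differentiable_comp
  (transition_differentiable s2 (chart_at_dom p) cp) d2).
Qed.

(** The transition to [c] sends the components of the [l]-th coordinate field back to the [l]-th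
    standard vector, so the chain rule leaves a second partial derivative of the transition from
    [c]. *)
Lemma coord_vector_derive c k l p : smooth_chart c -> chart_dom c p ->
  'D_(coord_vector c l p) (fun x => 'D_(delta_mx 0 k)
    (transition c (chart_at p)) (transition (chart_at p) c x)) (chart_point p) =
  'D_(delta_mx 0 l) ('D_(delta_mx 0 k) (transition c (chart_at p)))
    (chart_map c p).
Proof.
move=> [cc sc] cp; have [s1 s2] := sc _ (chart_at_atlas p).
have c0p := chart_at_dom p.
have d1 := transition_differentiable s2 c0p cp.
have d2 : differentiable ('D_(delta_mx 0 k) (transition c (chart_at p)))
    (transition (chart_at p) c (chart_point p)).
  rewrite transition_point.
  by apply: smooth_on_differentiable (smooth_on_derive _ s1) _; exists p.
apply: (etrans (derive_comp _ d1 d2)); rewrite transition_point.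
congr (derive _ _ _).
apply: (etrans (tangent_map_comp (delta_mx 0 l) cc (chart_at_chart p)
  s1 s2 cp c0p cp)).
exact: tangent_map_id.
Qed.

(** Coordinate fields commute, by symmetry of the second derivatives of the transition. *)
Lemma coord_vector_derive_swap c k l p : smooth_chart c -> chart_dom c p ->
  'D_(coord_vector c l p) (fun x => 'D_(delta_mx 0 k)
    (transition c (chart_at p)) (transition (chart_at p) c x)) (chart_point p) =
  'D_(coord_vector c k p) (fun x => 'D_(delta_mx 0 l)
    (transition c (chart_at p)) (transition (chart_at p) c x)) (chart_point p).
Proof.
move=> sc cp; apply: (etrans (coord_vector_derive k l sc cp)).
apply: (etrans _ (esym (coord_vector_derive l k sc cp))).
apply: smooth_on_derive_swap (sc.2 _ (chart_at_atlas p)).1.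
- exact: overlap_open sc.1 (chart_at_chart p).
- by exists p => //; split=> //; exact: chart_at_dom.
Qed.

(* The function [h(d_k, Y)] read in [chart_at p] near [p] (see
   [coord_pairing_near]), in a form that is visibly differentiable: the
   components of [d_k] are the [k]-th partial derivatives of the transition
   from [c]. *)
Definition coord_pairing c p k (Y : M -> 'rV[R]_2) (x : 'rV[R]_2) : R :=
  gram_form (metric_coef h (chart_at p) x)
    ('D_(delta_mx 0 k) (transition c (chart_at p)) (transition (chart_at p) c x))
    (components_near p Y x).

Lemma coord_pairing_near c p k Y : smooth_chart c -> chart_dom c p ->
  \forall x \near chart_point p, coord_pairing c p k Y x =
    inner h (chart_inv (chart_at p) x)
      (coord_vector c k (chart_inv (chart_at p) x))
      (Y (chart_inv (chart_at p) x)).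
Proof.
move=> sc cp; have near_dom := chart_near (chart_at_chart p) (chart_at_dom p)
  (@openT _) I.
apply: filterS2 near_dom (coord_vector_near k sc cp) => x [c0x xE _] Vx.
rewrite (inner_metric_coef h _ _ (chart_at_atlas p) c0x) xE.
by rewrite /coord_pairing -Vx.
Qed.

Lemma coord_pairing_differentiable c p k Y : smooth_chart c -> chart_dom c p ->
  differentiable (components_near p Y) (chart_point p) ->
  differentiable (coord_pairing c p k Y) (chart_point p).
Proof.
move=> sc cp dY; apply: gram_form_differentiable => //.
- exact: metric_coef_differentiable_point.
- exact: coord_vector_differentiable.
Qed.

(** In the product rule the derivatives of the coordinate fields cancel since these fields commute,
    and the derivatives of the metric become the Christoffel terms of [Y]. Only [Y] ends up
    covariantly differentiated. *)
Lemma coord_pairing_torsion c p k l Y : smooth_chart c -> chart_dom c p ->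
  differentiable (components_near p Y) (chart_point p) ->
  'D_(coord_vector c k p) (coord_pairing c p l Y) (chart_point p) -
  'D_(coord_vector c l p) (coord_pairing c p k Y) (chart_point p) =
  inner h p (coord_vector c l p) (levi_civita h p (coord_vector c k p) Y) -
  inner h p (coord_vector c k p) (levi_civita h p (coord_vector c l p) Y).
Proof.
move=> sc cp dY.
have dV m := coord_vector_differentiable m sc cp.
have dE l' k' :
    'D_(coord_vector c k' p) (coord_pairing c p l' Y) (chart_point p) =
    gram_form (dir_diff (metric_diff p) (coord_vector c k' p))
      (coord_vector c l' p) (Y p) +
    gram_form (gram h p) ('D_(coord_vector c k' p) (fun x => 'D_(delta_mx 0 l')
      (transition c (chart_at p)) (transition (chart_at p) c x)) (chart_point p))
      (Y p) +
    gram_form (gram h p) (coord_vector c l' p)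
      ('D_(coord_vector c k' p) (components_near p Y) (chart_point p)).
  apply: (etrans (inner_derive _ (dV l') dY)).
  by rewrite components_near_point transition_point.
have arith (a1 a2 a3 a4 a5 a5' a6 a7 : R) : a5 = a5' -> a1 - a2 = a3 - a4 ->
  a3 + a5 + a6 - (a4 + a5' + a7) = a6 + a1 - (a7 + a2) by move=> -> ?; lra.
apply: (etrans (congr2 (fun a b => a - b) (dE l k) (dE k l))).
apply: (etrans _ (esym (congr2 (fun a b => a - b)
  (inner_levi_civita _ _ _ _) (inner_levi_civita _ _ _ _)))).
apply: arith; last exact/lowered_christoffel_torsion/metric_diff_sym.
exact: (congr1 (fun Z => gram_form _ Z _) (coord_vector_derive_swap l k sc cp)).
Qed.

End levi_civita.

(** * Spinors in a local frame *)

Section spin_representation.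
Context {R : realType}.
Implicit Types (z w : 'cV[R[i]]_2) (s : R[i]).

Lemma gamma0_mul z :
  (gamma R 0 *m z) 0 0 = - z 1 0 /\ (gamma R 0 *m z) 1 0 = z 0 0.
Proof.
by split; rewrite mxE sum_ord2 !mxE /=
  !(subr0, sub0r, mul0r, mul1r, mulN1r, add0r, addr0).
Qed.

Lemma gamma1_mul z :
  (gamma R 1 *m z) 0 0 = 'i * z 1 0 /\ (gamma R 1 *m z) 1 0 = 'i * z 0 0.
Proof.
by split; rewrite mxE sum_ord2 !mxE /= !(mulr0, mulr1, mul0r, add0r, addr0).
Qed.

Lemma gamma01_mul z :
  (gamma R 0 *m gamma R 1 *m z) 0 0 = - 'i * z 0 0 /\
  (gamma R 0 *m gamma R 1 *m z) 1 0 = 'i * z 1 0.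
Proof.
rewrite -mulmxA; have [-> ->] := gamma0_mul (gamma R 1 *m z).
by have [-> ->] := gamma1_mul z; rewrite mulNr.
Qed.

(** The product of the two gamma matrices is diag(-i, i), so the spin representation splits into the
    characters [conjc s] and [s]. *)
Lemma spin_rep_mul s z :
  (spin_rep s *m z) 0 0 = conjc s * z 0 0 /\ (spin_rep s *m z) 1 0 = s * z 1 0.
Proof.
rewrite /spin_rep mulmxDl mul_scalar_mx -scalemxAl.
move: (gamma01_mul z); move: (gamma R 0 *m gamma R 1 *m z) => Z [g0 g1].
have sE : s = (complex.Re s)%:C + 'i * (complex.Im s)%:C by exact: complexE.
have sJ : conjc s = (complex.Re s)%:C - 'i * (complex.Im s)%:C.
  by case: s {sE} => x y /=; simpc.
by split; rewrite !mxE ?g0 ?g1 ?sJ; [ring|rewrite [X in _ = X * _]sE; ring].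
Qed.

Lemma hdotE z w : hdot z w = z 0 0 * conjc (w 0 0) + z 1 0 * conjc (w 1 0).
Proof. exact: sum_ord2. Qed.

Lemma cV2_eq z w : z 0 0 = w 0 0 -> z 1 0 = w 1 0 -> z = w.
Proof.
by move=> z0 z1; apply/colP; case=> -[|[|//]] i;
  rewrite -?(val_inj (erefl : val (0 : 'I_2) = val (Ordinal i)))
          -?(val_inj (erefl : val (1 : 'I_2) = val (Ordinal i))).
Qed.

End spin_representation.

Lemma det_mx2 (K : comNzRingType) (A : 'M[K]_2) :
  \det A = A 0 0 * A 1 1 - A 0 1 * A 1 0.
Proof.
rewrite (expand_det_row _ 0) sum_ord2 /cofactor !det_mx11 !mxE.
have -> : lift 0 0 = 1 :> 'I_2 by exact: val_inj.
have -> : lift 1 0 = 0 :> 'I_2 by exact: val_inj.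
by rewrite expr0 expr1; ring.
Qed.

(** An orthogonal matrix of positive determinant is a rotation: Lagrange's identity gives
    determinant 1, and then [(t - x) ^+ 2 + (z + y) ^+ 2] is 2 minus twice the determinant, hence
    zero. *)
Lemma rotation_entries (K : realFieldType) (x y z t : K) :
  x * x + y * y = 1 -> z * z + t * t = 1 -> x * z + y * t = 0 ->
  0 < x * t - y * z -> z = - y /\ t = x.
Proof.
move=> xy zt xz d0.
have d1 : x * t - y * z = 1.
  apply/eqP; rewrite -(@eqrXn2 _ 2)// ?ltW// expr1n; apply/eqP.
  have -> : (x * t - y * z) ^+ 2 =
    (x * x + y * y) * (z * z + t * t) - (x * z + y * t) ^+ 2 by ring.
  by rewrite xy zt xz; ring.
have s0 : (t - x) ^+ 2 + (z + y) ^+ 2 = 0.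
  have -> : (t - x) ^+ 2 + (z + y) ^+ 2 =
    (x * x + y * y) + (z * z + t * t) - 2 * (x * t - y * z) by ring.
  by rewrite xy zt d1; ring.
move/eqP: s0; rewrite paddr_eq0 ?sqr_ge0// !sqrf_eq0 subr_eq0 addr_eq0.
by move=> /andP[/eqP -> /eqP ->].
Qed.

(** * Changes of oriented orthonormal frame and their spin lifts *)

Section orthonormal_frames.
Context {R : realType} {M : closed_surface R} {h : metric M}.
Context (S : spin_structure h).
Implicit Types (a b : spin_index S) (p : M) (v w : 'rV[R]_2).

(** With the frame vectors as rows of [F], orthonormality says that the Gram matrix times the
    transpose of [F] is a right inverse of [F]; for square matrices it is also a left inverse, which
    is the expansion. *)
Lemma frame_expansion a p v : frame_dom a p ->
  v = inner h p v (frame a 0 p) *: frame a 0 p +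
      inner h p v (frame a 1 p) *: frame a 1 p.
Proof.
move=> ap; pose F : 'M[R]_2 := \matrix_(k < 2) frame a k p.
have FE k l : F k l = frame a k p 0 l by rewrite !mxE.
have FGF : F *m (gram h p *m F^T) = 1%:M.
  apply/matrixP => k l; rewrite [RHS]mxE -(frame_orthonormal ap) mulmxA.
  rewrite /inner /gram_form !mxE; apply: eq_bigr => j _.
  by rewrite !mxE; congr (_ * _); apply: eq_bigr => m _; rewrite FE.
have GFF : gram h p *m F^T *m F = 1%:M by exact: mulmx1C.
have {1}-> : v = (v *m gram h p *m F^T) *m F.
  by rewrite -!mulmxA [gram h p *m _]mulmxA GFF mulmx1.
have ME k : (v *m gram h p *m F^T) 0 k = inner h p v (frame a k p).
  rewrite /inner /gram_form !mxE; apply: eq_bigr => j _.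
  by rewrite [F^T _ _]mxE FE [(frame a k p)^T _ _]mxE.
by apply/rowP => j; rewrite mxE sum_ord2 !ME !FE !mxE.
Qed.

Lemma inner_frame a p v w : frame_dom a p ->
  inner h p v w = inner h p v (frame a 0 p) * inner h p (frame a 0 p) w +
                  inner h p v (frame a 1 p) * inner h p (frame a 1 p) w.
Proof.
move=> ap; rewrite [in LHS](frame_expansion v ap).
move: (inner h p v _) (inner h p v _) => x y.
by rewrite /inner !gram_formE !mxE; ring.
Qed.

Lemma frame_change a b p : frame_dom a p -> frame_dom b p ->
  inner h p (frame b 1 p) (frame a 0 p) =
    - inner h p (frame b 0 p) (frame a 1 p) /\
  inner h p (frame b 1 p) (frame a 1 p) = inner h p (frame b 0 p) (frame a 0 p).
Proof.
move=> ap bp.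
pose O : 'M[R]_2 := \matrix_(k, l) inner h p (frame b k p) (frame a l p).
have FO : \matrix_(k < 2) frame b k p = O *m \matrix_(k < 2) frame a k p.
  apply/row_matrixP => k; rewrite rowK row_mul; apply/rowP => j.
  by rewrite {1}(frame_expansion (frame b k p) ap) !mxE sum_ord2 !mxE.
have detO : 0 < \det O.
  have := frame_oriented bp; rewrite FO det_mulmx pmulr_lgt0//.
  exact: frame_oriented.
have OE k l : inner h p (frame b k p) (frame a l p) = O k l by rewrite mxE.
have OO k l : O k 0 * O l 0 + O k 1 * O l 1 = (k == l)%:R.
  rewrite -(frame_orthonormal bp) (inner_frame _ _ ap) !OE.
  by rewrite ![inner h p (frame a _ p) _]inner_sym !OE.
rewrite !OE; apply: rotation_entries; rewrite ?OO//.
by rewrite -det_mx2.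
Qed.

(** The frame identifies the oriented tangent plane with the complex numbers; the coordinate vectors
    have the coordinates [w_k] of the overview. *)
Definition frame_coord a p v : R[i] :=
  inner h p v (frame a 0 p) +i* inner h p v (frame a 1 p).

Lemma frame_coord_change a b p v : frame_dom a p -> frame_dom b p ->
  frame_coord a p v = spin_lift a b p ^+ 2 * frame_coord b p v.
Proof.
move=> ap bp; rewrite spin_lift_cover// /frame_coord.
rewrite (inner_frame v (frame a 0 p) bp) (inner_frame v (frame a 1 p) bp).
rewrite (frame_change ap bp).1 (frame_change ap bp).2.
move: (inner h p v (frame b 0 p)) (inner h p v (frame b 1 p)) => x y.
move: (inner h p _ (frame a 0 p)) (inner h p _ (frame a 1 p)) => z t.
by simpc; congr (_ +i* _); ring.
Qed.

(** The square of the lift has as real and imaginary parts the components of a unit vector, so its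
    modulus to the fourth power is 1, and a nonnegative square root of 1 is 1. *)
Lemma spin_lift_unitary a b p : frame_dom a p -> frame_dom b p ->
  spin_lift a b p * conjc (spin_lift a b p) = 1.
Proof.
move=> ap bp; have := spin_lift_cover ap bp.
have := frame_orthonormal bp 0 0; rewrite (inner_frame _ _ ap) eqxx mulr1n.
rewrite ![inner h p (frame a _ p) _]inner_sym.
move: (inner h p _ _) (inner h p _ _) (spin_lift a b p) => x y [s t] n.
rewrite expr2; simpc => -[sx ty].
have n2 : (s * s + t * t) ^+ 2 = 1.
  have -> : (s * s + t * t) ^+ 2 = (s * s - t * t) ^+ 2 + (s * t + t * s) ^+ 2.
    by ring.
  by rewrite sx ty -!expr2 in n *.
have {}n2 : s * s + t * t = 1.
  apply/eqP; rewrite -(@eqrXn2 _ 2)// ?expr1n ?n2//.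
  by rewrite -!expr2 addr_ge0 ?sqr_ge0.
by rewrite n2; congr (_ +i* _); ring.
Qed.

(** The cocycle relation makes this value idempotent, and unitarity makes it nonzero. *)
Lemma spin_lift_id a p : frame_dom a p -> spin_lift a a p = 1.
Proof.
move=> ap; have cc := spin_lift_cocycle ap ap ap.
have := spin_lift_unitary ap ap; case: (eqVneq (spin_lift a a p) 0) cc => [->|n0].
  by rewrite !mul0r => _ /esym/eqP; rewrite oner_eq0.
by move=> cc _; apply: (mulfI n0); rewrite cc mulr1.
Qed.

Lemma frame_coord0 a p : frame_dom a p -> frame_coord a p (frame a 0 p) = 1.
Proof. by move=> ap; rewrite /frame_coord !frame_orthonormal. Qed.

Lemma frame_coord1 a p : frame_dom a p -> frame_coord a p (frame a 1 p) = 'i.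
Proof. by move=> ap; rewrite /frame_coord !frame_orthonormal. Qed.

Lemma cliffordE p v z :
  clifford S p v z 0 0 = - conjc (frame_coord (frame_at S p) p v) * z 1 0 /\
  clifford S p v z 1 0 = frame_coord (frame_at S p) p v * z 0 0.
Proof.
rewrite /clifford sum_ord2 /frame_coord /oframe.
move: (inner h p v _) (inner h p v _) => x y.
move: (gamma0_mul z) (gamma1_mul z).
move: (gamma R 0 *m z) (gamma R 1 *m z) => Z0 Z1 [g00 g01] [g10 g11].
rewrite !mxE g00 g01 g10 g11; case: (z 0 0) (z 1 0) => [a b] [c d].
by split; simpc; congr (_ +i* _); ring.
Qed.

Lemma spinor_in_frameE a psi p :
  spinor_in_frame a psi p 0 0 =
    conjc (spin_lift a (frame_at S p) p) * psi p 0 0 /\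
  spinor_in_frame a psi p 1 0 = spin_lift a (frame_at S p) p * psi p 1 0.
Proof. exact: spin_rep_mul. Qed.

Lemma spinor_in_frame_at psi p : spinor_in_frame (frame_at S p) psi p = psi p.
Proof.
have := spinor_in_frameE (frame_at S p) psi p.
rewrite spin_lift_id; last exact: frame_at_dom.
by rewrite conjc1 !mul1r => -[? ?]; exact: cV2_eq.
Qed.

(** The freedom in [a] allows one frame to be kept near a point where the current is differentiated,
    whereas [frame_at] may jump. *)
Lemma noether_current_in_frame a c q (psi : 'I_q -> M -> 'cV[R[i]]_2) i m k p :
  frame_dom a p ->
  let w := frame_coord a p (coord_vector c k p) in
  let z j := spinor_in_frame a (psi j) p in
  noether_current S c psi i m k p =
  - w * (z i 0 0 * conjc (z m 1 0)) + conjc w * (z i 1 0 * conjc (z m 0 0)).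
Proof.
move=> ap; have bp := frame_at_dom S p; cbv zeta.
rewrite /noether_current hdotE.
have [-> ->] := cliffordE p (coord_vector c k p) (psi m p).
have [-> ->] := spinor_in_frameE a (psi i) p.
have [-> ->] := spinor_in_frameE a (psi m) p.
rewrite (frame_coord_change _ ap bp).
have := spin_lift_unitary ap bp.
move: (spin_lift _ _ _) (frame_coord _ _ _) => s w ss.
rewrite !(rmorphM, rmorphN, rmorphXn, conjcK) /=.
(* In each term the change of frame produces two factors [s] and two factors [conjc s]; the left
   side is multiplied by the square of [s * conjc s = 1] to match. *)
rewrite -[LHS]mul1r -[X in X * _](expr1n _ 2) -ss.
rewrite !(rmorphM, rmorphN, rmorphXn, conjcK) /=.
by ring.
Qed.

End orthonormal_frames.

(** * Derivatives of complex-valued functions *)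

Section complex_derivative.
Context {R : realType}.
Implicit Types (f g : 'rV[R]_2 -> R[i]) (x u v : 'rV[R]_2).

(** Real differentiability on the coordinate plane; no holomorphy is meant. *)
Definition cdifferentiable f x : Prop :=
  differentiable (fun y => complex.Re (f y) : R) x /\
  differentiable (fun y => complex.Im (f y) : R) x.

Definition is_cderive x v f (df : R[i]) : Prop :=
  is_derive x v (fun y => complex.Re (f y) : R) (complex.Re df) /\
  is_derive x v (fun y => complex.Im (f y) : R) (complex.Im df).

Lemma is_cderive_val x v f df : is_cderive x v f df -> cderive v f x = df.
Proof. by case: df => a b [[_ /= eR] [_ /= eI]]; rewrite /cderive eR eI. Qed.

Lemma cdifferentiable_is_cderive x v f : cdifferentiable f x ->
  is_cderive x v f (cderive v f x).
Proof. by move=> [dR dI]; split; exact: differentiable_is_derive. Qed.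

Lemma is_cderiveD x v f g df dg : is_cderive x v f df -> is_cderive x v g dg ->
  is_cderive x v (fun y => f y + g y) (df + dg).
Proof.
move=> [fR fI] [gR gI]; split.
  rewrite (_ : (fun _ => _) =
    (fun y => complex.Re (f y) + complex.Re (g y))); last first.
    by apply/funext => y; case: (f y) (g y) => ? ? [? ?].
  rewrite (_ : complex.Re (df + dg) = complex.Re df + complex.Re dg).
    exact: is_derive_addf.
  by case: df {fR fI} dg {gR gI} => ? ? [].
rewrite (_ : (fun _ => _) =
  (fun y => complex.Im (f y) + complex.Im (g y))); last first.
  by apply/funext => y; case: (f y) (g y) => ? ? [? ?].
rewrite (_ : complex.Im (df + dg) = complex.Im df + complex.Im dg).
  exact: is_derive_addf.
by case: df {fR fI} dg {gR gI} => ? ? [].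
Qed.

Lemma is_cderiveJ x v f df : is_cderive x v f df ->
  is_cderive x v (fun y => conjc (f y)) (conjc df).
Proof.
move=> [fR fI]; split.
  rewrite (_ : (fun _ => _) = (fun y => complex.Re (f y))); last first.
    by apply/funext => y; case: (f y).
  by case: df fR {fI}.
rewrite (_ : (fun _ => _) = (fun y => - complex.Im (f y))); last first.
  by apply/funext => y; case: (f y).
by case: df {fR} fI => a b /= fI; exact: is_deriveN.
Qed.

Lemma is_cderiveM x v f g df dg : is_cderive x v f df -> is_cderive x v g dg ->
  is_cderive x v (fun y => f y * g y) (df * g x + f x * dg).
Proof.
move=> [fR fI] [gR gI]; split.
  rewrite (_ : (fun _ => _) = (fun y => complex.Re (f y) * complex.Re (g y) -
    complex.Im (f y) * complex.Im (g y))); last first.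
    by apply/funext => y; case: (f y) (g y) => ? ? [? ?].
  apply: is_derive_eq (is_deriveB (is_derive_mulf fR gR) (is_derive_mulf fI gI)) _.
  by case: df {fR fI} dg {gR gI} (f x) (g x) => ? ? [? ?] [? ?] [? ?] /=; ring.
rewrite (_ : (fun _ => _) = (fun y => complex.Re (f y) * complex.Im (g y) +
  complex.Im (f y) * complex.Re (g y))); last first.
  by apply/funext => y; case: (f y) (g y) => ? ? [? ?].
apply: is_derive_eq (is_derive_addf (is_derive_mulf fR gI) (is_derive_mulf fI gR)) _.
by case: df {fR fI} dg {gR gI} (f x) (g x) => ? ? [? ?] [? ?] [? ?] /=; ring.
Qed.

Lemma cderive_comp x v f (T : 'rV[R]_2 -> 'rV[R]_2) : differentiable T x ->
  cdifferentiable f (T x) ->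
  cderive v (fun y => f (T y)) x = cderive ('D_v T x) f (T x).
Proof.
move=> dT [dR dI].
by rewrite /cderive (derive_comp _ dT dR) (derive_comp _ dT dI).
Qed.

Lemma near_eq_cderive x v f g : (\forall y \near x, f y = g y) ->
  cderive v f x = cderive v g x.
Proof.
move=> fg; rewrite /cderive; congr (_ +i* _); apply: near_eq_derive;
  by apply: filterS fg => y ->.
Qed.

Lemma cderive_dir x u v (a b : R) f : cdifferentiable f x ->
  cderive (a *: u + b *: v) f x = a%:C * cderive u f x + b%:C * cderive v f x.
Proof.
move=> [dR dI]; rewrite /cderive.
rewrite (derive_dirD _ _ dR) (derive_dirD _ _ dI).
rewrite (derive_dirZ _ _ dR) (derive_dirZ _ _ dI) (derive_dirZ _ _ dR).
rewrite (derive_dirZ _ _ dI).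
by simpc.
Qed.

Lemma is_cderiveN x v f df : is_cderive x v f df ->
  is_cderive x v (fun y => - f y) (- df).
Proof.
move=> [fR fI]; split.
  rewrite (_ : (fun _ => _) = (fun y => - complex.Re (f y))); last first.
    by apply/funext => y; case: (f y).
  by case: df fR {fI} => a b /= fR; exact: is_deriveN.
rewrite (_ : (fun _ => _) = (fun y => - complex.Im (f y))); last first.
  by apply/funext => y; case: (f y).
by case: df {fR} fI => a b /= fI; exact: is_deriveN.
Qed.

Lemma cdifferentiableN f x : cdifferentiable f x ->
  cdifferentiable (fun y => - f y) x.
Proof.
move=> [fR fI]; split.
  rewrite (_ : (fun _ => _) = (fun y => - complex.Re (f y))); last first.
    by apply/funext => y; case: (f y).
  exact: differentiableN.
rewrite (_ : (fun _ => _) = (fun y => - complex.Im (f y))); last first.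
  by apply/funext => y; case: (f y).
exact: differentiableN.
Qed.

Lemma cdifferentiableJ f x : cdifferentiable f x ->
  cdifferentiable (fun y => conjc (f y)) x.
Proof.
move=> [fR fI]; split.
  rewrite (_ : (fun _ => _) = (fun y => complex.Re (f y))); last first.
    by apply/funext => y; case: (f y).
  exact: fR.
rewrite (_ : (fun _ => _) = (fun y => - complex.Im (f y))); last first.
  by apply/funext => y; case: (f y).
exact: differentiableN.
Qed.

Lemma cdifferentiableD f g x : cdifferentiable f x -> cdifferentiable g x ->
  cdifferentiable (fun y => f y + g y) x.
Proof.
move=> [fR fI] [gR gI]; split.
  rewrite (_ : (fun _ => _) =
    (fun y => complex.Re (f y) + complex.Re (g y))); last first.
    by apply/funext => y; case: (f y) (g y) => ? ? [? ?].
  exact: differentiable_addf.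
rewrite (_ : (fun _ => _) =
  (fun y => complex.Im (f y) + complex.Im (g y))); last first.
  by apply/funext => y; case: (f y) (g y) => ? ? [? ?].
exact: differentiable_addf.
Qed.

Lemma cdifferentiableM f g x : cdifferentiable f x -> cdifferentiable g x ->
  cdifferentiable (fun y => f y * g y) x.
Proof.
move=> [fR fI] [gR gI]; split.
  rewrite (_ : (fun _ => _) = (fun y => complex.Re (f y) * complex.Re (g y) -
    complex.Im (f y) * complex.Im (g y))); last first.
    by apply/funext => y; case: (f y) (g y) => ? ? [? ?].
  exact: (differentiableB (differentiable_mulf fR gR) (differentiable_mulf fI gI)).
rewrite (_ : (fun _ => _) = (fun y => complex.Re (f y) * complex.Im (g y) +
  complex.Im (f y) * complex.Re (g y))); last first.
  by apply/funext => y; case: (f y) (g y) => ? ? [? ?].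
exact: (differentiable_addf (differentiable_mulf fR gI) (differentiable_mulf fI gR)).
Qed.

End complex_derivative.

(** * The connection form of an orthonormal frame *)

Section connection_form.
Context {R : realType} {M : closed_surface R} {h : metric M}.
Context (S : spin_structure h).
Implicit Types (a : spin_index S) (p : M) (u v w : 'rV[R]_2) (c : chart R M).

Lemma frame_differentiable a k p : frame_dom a p ->
  differentiable (components_near p (frame a k)) (chart_point p).
Proof.
move=> ap.
apply: (smooth_on_differentiable (frame_smooth a k (chart_at_atlas p))).
by exists p => //; split=> //; exact: chart_at_dom.
Qed.

(** By metricity the left side is the derivative of the pairing of two frame vectors, which is
    constant near [p]. *)
Lemma frame_nabla_skew a k l p v : frame_dom a p ->
  inner h p (levi_civita h p v (frame a k)) (frame a l p) +
  inner h p (frame a k p) (levi_civita h p v (frame a l)) = 0.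
Proof.
move=> ap.
rewrite -(levi_civita_metric h v (frame_differentiable k ap)
  (frame_differentiable l ap)).
rewrite -[RHS](derive_cst ((k == l)%:R : R) (chart_point p) v).
apply: near_eq_derive.
apply: filterS (chart_near (chart_at_chart p) (chart_at_dom p)
  (frame_dom_open a) ap) => x [c0x xE ax].
rewrite /cst -(frame_orthonormal ax).
by rewrite (inner_metric_coef h _ _ (chart_at_atlas p) c0x) xE.
Qed.

Definition connection_form a p v : R :=
  inner h p (levi_civita h p v (frame a 0)) (frame a 1 p).

Lemma connection_form_lin a p u v (s t : R) : frame_dom a p ->
  connection_form a p (s *: u + t *: v) =
  s * connection_form a p u + t * connection_form a p v.
Proof.
move=> ap; rewrite /connection_form !(inner_sym h p (levi_civita _ _ _ _)).
rewrite !inner_levi_civita.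
have d := frame_differentiable 0 ap.
rewrite (derive_dirD _ _ d) (derive_dirZ u s d) (derive_dirZ v t d).
move: ('D_u _ _) ('D_v _ _) (metric_diff h p) => du dv dg.
rewrite /lowered_christoffel !gram_formE !mxE !sum_ord2 !mxE.
by field.
Qed.

(** The covariant derivative of a unit field is orthogonal to it, so only the other frame vector
    contributes. *)
Lemma inner_nabla_frame0 a p v w : frame_dom a p ->
  inner h p w (levi_civita h p v (frame a 0)) =
  inner h p w (frame a 1 p) * connection_form a p v.
Proof.
move=> ap; rewrite (inner_frame _ _ ap).
have := frame_nabla_skew 0 0 v ap.
rewrite [X in X + _]inner_sym => e.
have -> : inner h p (frame a 0 p) (levi_civita h p v (frame a 0)) = 0 by lra.
by rewrite mulr0 add0r [X in _ * X]inner_sym.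
Qed.

Lemma inner_nabla_frame1 a p v w : frame_dom a p ->
  inner h p w (levi_civita h p v (frame a 1)) =
  - (inner h p w (frame a 0 p) * connection_form a p v).
Proof.
move=> ap; rewrite (inner_frame _ _ ap).
have := frame_nabla_skew 1 1 v ap.
rewrite [X in X + _]inner_sym => e.
have -> : inner h p (frame a 1 p) (levi_civita h p v (frame a 1)) = 0 by lra.
have := frame_nabla_skew 0 1 v ap; rewrite -/(connection_form a p v).
move=> /eqP; rewrite addrC addr_eq0 => /eqP ->.
by rewrite mulr0 addr0 mulrN.
Qed.

(** The function [w_k] near [p], in the form whose differentiability is visible. *)
Definition coord_frame_coord a c p k (x : 'rV[R]_2) : R[i] :=
  coord_pairing h c p k (frame a 0) x +i* coord_pairing h c p k (frame a 1) x.

Lemma coord_frame_coord_near a c p k : smooth_chart c -> chart_dom c p ->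
  \forall x \near chart_point p, coord_frame_coord a c p k x =
    frame_coord a (chart_inv (chart_at p) x)
      (coord_vector c k (chart_inv (chart_at p) x)).
Proof.
move=> sc cp.
apply: filterS2 (coord_pairing_near h k (frame a 0) sc cp)
  (coord_pairing_near h k (frame a 1) sc cp) => x e0 e1.
by rewrite /coord_frame_coord e0 e1.
Qed.

Lemma coord_frame_coord_cdifferentiable a c p k :
  smooth_chart c -> chart_dom c p -> frame_dom a p ->
  cdifferentiable (coord_frame_coord a c p k) (chart_point p).
Proof.
move=> sc cp ap; split;
  exact: (coord_pairing_differentiable h k sc cp (frame_differentiable _ ap)).
Qed.

(** Cartan's first structure equation for the complex coframe with values [w_k] on the coordinate
    fields: its exterior derivative is -i times the wedge of the connection form with it. *)
Lemma coord_frame_coord_torsion a c p :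
  smooth_chart c -> chart_dom c p -> frame_dom a p ->
  let v k := coord_vector c k p in let w := coord_frame_coord a c p in
  cderive (v 0) (w 1) (chart_point p) - cderive (v 1) (w 0) (chart_point p) =
  - 'i * (frame_coord a p (v 1) * (connection_form a p (v 0))%:C -
          frame_coord a p (v 0) * (connection_form a p (v 1))%:C).
Proof.
move=> sc cp ap v w.
have t0 := coord_pairing_torsion h 0 1 sc cp (frame_differentiable 0 ap).
have t1 := coord_pairing_torsion h 0 1 sc cp (frame_differentiable 1 ap).
rewrite (inner_nabla_frame0 (v 0) (v 1) ap) in t0.
rewrite (inner_nabla_frame0 (v 1) (v 0) ap) in t0.
rewrite (inner_nabla_frame1 (v 0) (v 1) ap) in t1.
rewrite (inner_nabla_frame1 (v 1) (v 0) ap) in t1.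
have arith (x y b0 b1 d0 d1 : R) :
  (d1 * x - b1 * y) +i* (- (d0 * x) - - (b0 * y)) =
  - 'i * ((d0 +i* d1) * x%:C - (b0 +i* b1) * y%:C).
  by simpc; congr (_ +i* _); ring.
apply: etrans (arith _ _ _ _ _ _).
exact: (congr2 (fun x y => x +i* y) t0 t1).
Qed.

End connection_form.

(* Primed variables stand for complex conjugates and [I] for the imaginary unit;
   keeping them formal makes the identity one of commutative rings. *)
Lemma curl_ring (K : comPzRingType) (I u00 u01 u10 u11 t0 t1 mu
    D01 D10 D01' D10' ai bi am' bm' ai0 ai1 bi0 bi1 am0' am1' bm0' bm1' : K) :
  I * I = -1 ->
  let w0 := u00 + I * u01 in let w1 := u10 + I * u11 in
  let w0' := u00 - I * u01 in let w1' := u10 - I * u11 in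
  let r0 := u00 * (2 * t0) + u01 * (2 * t1) in
  let r1 := u10 * (2 * t0) + u11 * (2 * t1) in
  D01 - D10 = - I * (w1 * r0 - w0 * r1) ->
  D01' - D10' = I * (w1' * r0 - w0' * r1) ->
  ai0 = mu * bi + I * t0 * ai - I * (ai1 - I * t1 * ai) ->
  bi0 = - mu * ai - I * t0 * bi + I * (bi1 + I * t1 * bi) ->
  am0' = mu * bm' - I * t0 * am' + I * (am1' + I * t1 * am') ->
  bm0' = - mu * am' + I * t0 * bm' - I * (bm1' - I * t1 * bm') ->
  let dJ w w' D D' s t :=
    (- D * (ai * bm') +
     - w * ((s * ai0 + t * ai1) * bm' + ai * (s * bm0' + t * bm1'))) +
    (D' * (bi * am') +
     w' * ((s * bi0 + t * bi1) * am' + bi * (s * am0' + t * am1'))) in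
  dJ w1 w1' D01 D01' u00 u01 - dJ w0 w0' D10 D10' u10 u11 =
  2 * mu * (I * (u00 * u11 - u01 * u10) * (ai * am' - bi * bm')).
Proof.
move=> II /= /eqP; rewrite subr_eq => /eqP ->.
move=> /eqP; rewrite subr_eq => /eqP -> -> -> -> ->.
by ring: II.
Qed.

(** * The Dirac operator and chirality in components *)

Section dirac_in_frame.
Context {R : realType} {M : closed_surface R} {h : metric M}.
Context (S : spin_structure h).
Implicit Types (p : M) (v : 'rV[R]_2) (psi : M -> 'cV[R[i]]_2).

(** The frame and the chart are those chosen at [p], kept fixed while the point moves, as in
    [spin_connection]. *)
Definition spinor_near psi p (k : 'I_2) (x : 'rV[R]_2) : R[i] :=
  spinor_in_frame (frame_at S p) psi (chart_inv (chart_at p) x) k 0.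

Lemma spinor_near_point psi p k :
  spinor_near psi p k (chart_point p) = psi p k 0.
Proof. by rewrite /spinor_near chart_inv_point spinor_in_frame_at. Qed.

Lemma spinor_near_cdifferentiable psi p k : smooth_spinor S psi ->
  cdifferentiable (spinor_near psi p k) (chart_point p).
Proof.
move=> spsi; have [sR sI] := spsi (frame_at S p) k.
have pdom : (chart_map (chart_at p) @`
    (frame_dom (frame_at S p) `&` chart_dom (chart_at p))) (chart_point p).
  by exists p => //; split; [exact: frame_at_dom|exact: chart_at_dom].
split; [exact: (smooth_on_differentiable (sR _ (chart_at_atlas p)) pdom)|].
exact: (smooth_on_differentiable (sI _ (chart_at_atlas p)) pdom).
Qed.

Lemma spin_connectionE psi p v :
  let t := 2^-1 * connection_form (frame_at S p) p v in
  spin_connection S p v psi 0 0 =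
    cderive v (spinor_near psi p 0) (chart_point p) - 'i * t%:C * psi p 0 0 /\
  spin_connection S p v psi 1 0 =
    cderive v (spinor_near psi p 1) (chart_point p) + 'i * t%:C * psi p 1 0.
Proof.
rewrite /spin_connection -/(connection_form (frame_at S p) p v).
move: (connection_form _ _ _) => th; cbv zeta.
move: (gamma01_mul (psi p)); move: (gamma R 0 *m gamma R 1 *m psi p) => Z [g0 g1].
have sE (x y : 'cV[R[i]]_2) k : (x + y) k 0 = x k 0 + y k 0 by rewrite mxE.
have zE (x : R[i]) (y : 'cV[R[i]]_2) k : (x *: y) k 0 = x * y k 0 by rewrite mxE.
have cE (f : 'I_2 -> R[i]) k : (\col_k' f k') k 0 = f k by rewrite mxE.
by split; rewrite sE zE cE ?g0 ?g1 ?mulNr ?mulrN mulrCA mulrA.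
Qed.

Lemma dirac_operatorE psi p :
  let D k := spin_connection S p (oframe S k p) psi in
  dirac_operator S psi p 0 0 = - D 0 1 0 + 'i * D 1 1 0 /\
  dirac_operator S psi p 1 0 = D 0 0 0 + 'i * D 1 0 0.
Proof.
move=> D; rewrite /dirac_operator sum_ord2 -/(D 0) -/(D 1).
move: (D 0) (D 1) => z0 z1; rewrite !mxE.
have ap := frame_at_dom S p.
have [-> ->] := cliffordE S p (oframe S 0 p) z0.
have [-> ->] := cliffordE S p (oframe S 1 p) z1.
rewrite frame_coord0// frame_coord1// conjc1 mul1r mulN1r.
by split=> //; congr (_ + _ * _); simpc.
Qed.

(** The two components of the Dirac equation are solved for the derivatives along the first frame
    vector, so that these can be eliminated from the curl; those along the second stay free. *)
Lemma dirac_solved psi p (mu : R) :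
  dirac_operator S psi p = mu%:C *: psi p ->
  let t k := 2^-1 * connection_form (frame_at S p) p (oframe S k p) in
  let d l k := cderive (oframe S k p) (spinor_near psi p l) (chart_point p) in
  d 0 0 = mu%:C * psi p 1 0 + 'i * (t 0)%:C * psi p 0 0
          - 'i * (d 0 1 - 'i * (t 1)%:C * psi p 0 0) /\
  d 1 0 = - mu%:C * psi p 0 0 - 'i * (t 0)%:C * psi p 1 0
          + 'i * (d 1 1 + 'i * (t 1)%:C * psi p 1 0).
Proof.
move=> dirac t d.
have zE (x : R[i]) (y : 'cV[R[i]]_2) k : (x *: y) k 0 = x * y k 0 by rewrite mxE.
have [e0 e1] := dirac_operatorE psi p; move: e0 e1.
rewrite dirac !zE.
have [-> ->] := spin_connectionE psi p (oframe S 0 p).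
have [-> ->] := spin_connectionE psi p (oframe S 1 p).
rewrite -/(t 0) -/(t 1) -/(d 0 0) -/(d 0 1) -/(d 1 0) -/(d 1 1).
move: (d 0 0) (d 0 1) (d 1 0) (d 1 1) (t 0) (t 1) => d00 d01 d10 d11 t0 t1.
by move=> e0 e1; rewrite mulNr e0 e1; split; ring.
Qed.

(** The volume element is diag(1, -1): the two components are the positive and the negative
    half-spinor, which turns the chirality hypothesis into a relation between components. *)
Lemma complex_volumeE p z :
  complex_volume S p z 0 0 = z 0 0 /\ complex_volume S p z 1 0 = - z 1 0.
Proof.
have ap := frame_at_dom S p; rewrite /complex_volume.
have zE (x : R[i]) (y : 'cV[R[i]]_2) k : (x *: y) k 0 = x * y k 0 by rewrite mxE.
rewrite !zE.
have II : 'i * 'i = -1 :> R[i] by rewrite -expr2 sqr_i.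
have iJ : conjc 'i = - 'i :> R[i] by simpc.
have [-> ->] := cliffordE S p (oframe S 0 p) (clifford S p (oframe S 1 p) z).
have [-> ->] := cliffordE S p (oframe S 1 p) z.
rewrite frame_coord0// frame_coord1// conjc1 iJ.
rewrite !complexiE.
by split; ring: II.
Qed.

Lemma hdot_proj_pos p z w :
  hdot (proj_pos S p z) (proj_pos S p w) = z 0 0 * conjc (w 0 0).
Proof.
have pE y : proj_pos S p y 0 0 = y 0 0 /\ proj_pos S p y 1 0 = 0.
  rewrite /proj_pos; move: (complex_volumeE p y).
  move: (complex_volume S p y) => Z [e0 e1]; rewrite !mxE e0 e1.
  by split; [field|rewrite subrr mulr0].
have hE (y y' : 'cV[R[i]]_2) : y 1 0 = 0 -> hdot y y' = y 0 0 * conjc (y' 0 0).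
  by move=> y1; rewrite hdotE y1 mul0r addr0.
apply: (etrans (hE _ _ (pE z).2)).
exact: (congr2 (fun x y => x * conjc y) (pE z).1 (pE w).1).
Qed.

Lemma hdot_proj_neg p z w :
  hdot (proj_neg S p z) (proj_neg S p w) = z 1 0 * conjc (w 1 0).
Proof.
have pE y : proj_neg S p y 0 0 = 0 /\ proj_neg S p y 1 0 = y 1 0.
  rewrite /proj_neg; move: (complex_volumeE p y).
  move: (complex_volume S p y) => Z [e0 e1]; rewrite !mxE e0 e1.
  by split; [rewrite subrr mulr0|field].
have hE (y y' : 'cV[R[i]]_2) : y 0 0 = 0 -> hdot y y' = y 1 0 * conjc (y' 1 0).
  by move=> y0; rewrite hdotE y0 mul0r add0r.
apply: (etrans (hE _ _ (pE z).1)).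
exact: (congr2 (fun x y => x * conjc y) (pE z).2 (pE w).2).
Qed.

End dirac_in_frame.

(** * The Noether current *)

Section noether_derivative.
Context {R : realType} {M : closed_surface R} {h : metric M}.
Context (S : spin_structure h) (c : chart R M) (q : nat).
Context (psi : 'I_q -> M -> 'cV[R[i]]_2).
Context (c_smooth : smooth_chart c).
Context (psi_smooth : forall i, smooth_spinor S (psi i)).
Implicit Types (p : M) (i m : 'I_q) (k l : 'I_2).

(** The current near [p] in the frame and chart fixed at [p], as a polynomial in differentiable
    functions and their conjugates. *)
Definition noether_near i m k p (x : 'rV[R]_2) : R[i] :=
  - coord_frame_coord (frame_at S p) c p k x *
    (spinor_near S (psi i) p 0 x * conjc (spinor_near S (psi m) p 1 x)) +
  conjc (coord_frame_coord (frame_at S p) c p k x) *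
    (spinor_near S (psi i) p 1 x * conjc (spinor_near S (psi m) p 0 x)).

Lemma noether_near_cdifferentiable i m k p : chart_dom c p ->
  cdifferentiable (noether_near i m k p) (chart_point p).
Proof.
move=> cp; have dz j l := spinor_near_cdifferentiable p l (psi_smooth j).
have dw := coord_frame_coord_cdifferentiable k c_smooth cp (frame_at_dom S p).
exact: (cdifferentiableD
  (cdifferentiableM (cdifferentiableN dw)
    (cdifferentiableM (dz i 0) (cdifferentiableJ (dz m 1))))
  (cdifferentiableM (cdifferentiableJ dw)
    (cdifferentiableM (dz i 1) (cdifferentiableJ (dz m 0))))).
Qed.

Lemma noether_near_cderive i m k p v : chart_dom c p ->
  let a := frame_at S p in let x := chart_point p in
  let w := frame_coord a p (coord_vector c k p) in
  let dw := cderive v (coord_frame_coord a c p k) x in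
  let dz j l := cderive v (spinor_near S (psi j) p l) x in
  let z j := psi j p in
  cderive v (noether_near i m k p) x =
  (- dw * (z i 0 0 * conjc (z m 1 0)) +
   - w * (dz i 0 * conjc (z m 1 0) + z i 0 0 * conjc (dz m 1))) +
  (conjc dw * (z i 1 0 * conjc (z m 0 0)) +
   conjc w * (dz i 1 * conjc (z m 0 0) + z i 1 0 * conjc (dz m 0))).
Proof.
move=> cp a x w dw dz z.
have hz j l := cdifferentiable_is_cderive v
  (spinor_near_cdifferentiable p l (psi_smooth j)).
have hw := cdifferentiable_is_cderive v
  (coord_frame_coord_cdifferentiable k c_smooth cp (frame_at_dom S p)).
have wE : coord_frame_coord a c p k x = w.
  rewrite (nbhs_singleton (coord_frame_coord_near a k c_smooth cp)).
  by rewrite chart_inv_point.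
apply: (etrans (is_cderive_val (is_cderiveD
  (is_cderiveM (is_cderiveN hw) (is_cderiveM (hz i 0) (is_cderiveJ (hz m 1))))
  (is_cderiveM (is_cderiveJ hw) (is_cderiveM (hz i 1) (is_cderiveJ (hz m 0))))))).
by rewrite !spinor_near_point wE.
Qed.

(** [coord_diff] reads the current in [c], the local expression lives in [chart_at p]. The
    differential of the transition between them sends the [l]-th standard vector to
    [coord_vector c l p]. *)
Lemma coord_diff_noether i m k l p : chart_dom c p ->
  coord_diff c l (noether_current S c psi i m k) p =
  cderive (coord_vector c l p) (noether_near i m k p) (chart_point p).
Proof.
move=> cp; have c0p := chart_at_dom p.
have [cc sc] := c_smooth; have [s1 _] := sc _ (chart_at_atlas p).
have dT := transition_differentiable s1 cp c0p.
have TE : transition c (chart_at p) (chart_map c p) = chart_point p.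
  by rewrite /transition; have [_ _ -> //] := cc.
have dJ : cdifferentiable (noether_near i m k p)
    (transition c (chart_at p) (chart_map c p)).
  by rewrite TE; exact: noether_near_cdifferentiable.
apply: (etrans _ (etrans (cderive_comp (delta_mx 0 l) dT dJ) _)); last first.
  by rewrite TE.
apply: near_eq_cderive.
have near_dom := chart_near cc cp (frame_dom_open (frame_at S p))
  (frame_at_dom S p).
have [oc0 _ c0i _ _] := chart_at_chart p.
have near_dom0 := chart_near cc cp oc0 c0p.
have near_w : \forall x \near chart_map c p,
    coord_frame_coord (frame_at S p) c p k (transition c (chart_at p) x) =
    frame_coord (frame_at S p) (chart_inv (chart_at p) (transition c (chart_at p) x))
      (coord_vector c k (chart_inv (chart_at p) (transition c (chart_at p) x))).
  have := coord_frame_coord_near (frame_at S p) k c_smooth cp.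
  by rewrite -TE => /(differentiable_continuous dT).
apply: filterS3 near_dom near_dom0 near_w => x [_ _ ax] [_ _ c0x] wx.
have ix : chart_inv (chart_at p) (transition c (chart_at p) x) = chart_inv c x.
  exact: c0i.
rewrite /noether_near wx /spinor_near ix.
exact: noether_current_in_frame.
Qed.

End noether_derivative.

(** * The curl of the current in components *)

Section current_curl.
Context {R : realType}.

Definition dir_sum (s t : R) (z0 z1 : R[i]) : R[i] := s%:C * z0 + t%:C * z1.

(** The Leibniz expansion of - w a conj(b') + conj(w) b conj(a'). Here primes mark the components of
    the second spinor, not conjugates. *)
Definition current_variation (a b a' b' : R[i]) (w dw da db da' db' : R[i]) :=
  (- dw * (a * conjc b') + - w * (da * conjc b' + a * conjc db')) +
  (conjc dw * (b * conjc a') + conjc w * (db * conjc a' + b * conjc da')).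

(** The complex instance of [curl_ring]: [u_kl] are the components of the coordinate vectors in the
    frame, and [t0], [t1] are half the connection form on it. The relations between conjugates come
    from conjugating the torsion identity and the equations of the second spinor. *)
Lemma current_curl (u00 u01 u10 u11 t0 t1 mu : R)
    (D01 D10 ai bi am bm ai0 ai1 bi0 bi1 am0 am1 bm0 bm1 : R[i]) :
  D01 - D10 =
    - 'i * ((u10 +i* u11) * (u00 * (2 * t0) + u01 * (2 * t1))%:C -
            (u00 +i* u01) * (u10 * (2 * t0) + u11 * (2 * t1))%:C) ->
  ai0 = mu%:C * bi + 'i * t0%:C * ai - 'i * (ai1 - 'i * t1%:C * ai) ->
  bi0 = - mu%:C * ai - 'i * t0%:C * bi + 'i * (bi1 + 'i * t1%:C * bi) ->
  am0 = mu%:C * bm + 'i * t0%:C * am - 'i * (am1 - 'i * t1%:C * am) ->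
  bm0 = - mu%:C * am - 'i * t0%:C * bm + 'i * (bm1 + 'i * t1%:C * bm) ->
  let dJ w D s t := current_variation ai bi am bm w D
    (dir_sum s t ai0 ai1) (dir_sum s t bi0 bi1)
    (dir_sum s t am0 am1) (dir_sum s t bm0 bm1) in
  dJ (u10 +i* u11) D01 u00 u01 - dJ (u00 +i* u01) D10 u10 u11 =
  2 * mu%:C * ('i * (u00 * u11 - u01 * u10)%:C *
    (ai * conjc am - bi * conjc bm)).
Proof.
have II : 'i * 'i = -1 :> R[i] by rewrite -expr2 sqr_i.
have iJ : conjc 'i = - 'i :> R[i] by rewrite -complexiE; simpc.
have wE (x y : R) : x +i* y = x%:C + 'i * y%:C by rewrite -complexiE; simpc.
have wJ (x y : R) : conjc (x +i* y) = x%:C - 'i * y%:C.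
  by rewrite -complexiE; simpc.
have JD (z z' : R[i]) : conjc (z + z') = conjc z + conjc z' by exact: rmorphD.
have JN (z : R[i]) : conjc (- z) = - conjc z by exact: rmorphN.
have JM (z z' : R[i]) : conjc (z * z') = conjc z * conjc z' by exact: rmorphM.
have JR (x : R) : conjc x%:C = x%:C by exact: conjc_real.
have CD (x y : R) : (x + y)%:C = x%:C + y%:C by exact: rmorphD.
have CN (x : R) : (- x)%:C = - x%:C by exact: rmorphN.
have CM (x y : R) : (x * y)%:C = x%:C * y%:C by exact: rmorphM.
have C2 : (2 : R)%:C = 2 by exact: rmorph_nat.
move=> hD hai hbi ham hbm dJ.
have hD' : conjc D01 - conjc D10 =
    'i * ((u10%:C - 'i * u11%:C) * (u00%:C * (2 * t0%:C) + u01%:C * (2 * t1%:C)) -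
          (u00%:C - 'i * u01%:C) * (u10%:C * (2 * t0%:C) + u11%:C * (2 * t1%:C))).
  rewrite -JN -JD hD !(iJ, JR, JM, JD, JN, wJ) opprK.
  by rewrite !(CD, CM, C2).
rewrite /dJ /current_variation /dir_sum !(JR, JD, JM, wJ) !wE !(CD, CN, CM).
apply: curl_ring II _ hD' hai hbi _ _.
- by rewrite hD !wE !(CD, CM, C2).
- by rewrite ham !(iJ, JR, JM, JD, JN); ring.
- by rewrite hbm !(iJ, JR, JM, JD, JN); ring.
Qed.

End current_curl.

(** * Commutator of currents and double Clifford product *)

Section current_products.
Context {R : realType}.

(** The terms in [w0 * w1] and in its conjugate cancel; the mixed ones carry
    [conjc w0 * w1 - w0 * conjc w1], which is 2i times the determinant. *)
Lemma current_commutator (u00 u01 u10 u11 : R) (ai bi aj bj am bm : R[i]) :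
  let J w a b a' b' := - w * (a * conjc b') + conjc w * (b * conjc a') in
  let w0 := u00 +i* u01 in let w1 := u10 +i* u11 in
  J w0 ai bi aj bj * J w1 aj bj am bm - J w1 ai bi aj bj * J w0 aj bj am bm =
  2 * ('i * (u00 * u11 - u01 * u10)%:C) *
  (bj * conjc bj * (ai * conjc am) - aj * conjc aj * (bi * conjc bm)).
Proof.
move=> J w0 w1; rewrite -complexiE.
have wP : conjc w0 * w1 - w0 * conjc w1 = 2 * ('i%C * (u00 * u11 - u01 * u10)%:C).
  by rewrite /w0 /w1 mulrDl mul1r; simpc; congr (_ +i* _); ring.
by rewrite -wP /J; ring.
Qed.

(** Orthogonality makes [conjc w0 * w1] purely imaginary, equal to i times the determinant.
    Isothermality of the coordinates enters the computation here. *)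
Lemma orthogonal_product (u00 u01 u10 u11 : R) (ai bi am bm : R[i]) :
  u00 * u10 + u01 * u11 = 0 ->
  let w0 := u00 +i* u01 in let w1 := u10 +i* u11 in
  ai * conjc (- conjc w0 * (w1 * am)) + bi * conjc (w0 * (- conjc w1 * bm)) =
  'i * (u00 * u11 - u01 * u10)%:C * (ai * conjc am - bi * conjc bm).
Proof.
move=> orth w0 w1; rewrite -complexiE.
have JM (z z' : R[i]) : conjc (z * z') = conjc z * conjc z' by exact: rmorphM.
have JN (z : R[i]) : conjc (- z) = - conjc z by exact: rmorphN.
have wP : w0 * conjc w1 = - ('i%C * (u00 * u11 - u01 * u10)%:C).
  by rewrite /w0 /w1; simpc; congr (_ +i* _); lra.
have wP' : conjc w0 * w1 = 'i%C * (u00 * u11 - u01 * u10)%:C.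
  by rewrite /w0 /w1; simpc; congr (_ +i* _); lra.
rewrite !(JM, JN) !conjcK.
have -> : - w0 * (conjc w1 * conjc am) = - (w0 * conjc w1) * conjc am by ring.
have -> : conjc w0 * (- w1 * conjc bm) = - (conjc w0 * w1) * conjc bm by ring.
by rewrite wP wP'; ring.
Qed.

End current_products.

(** * The curl identity at a point, in the frame chosen there *)

Theorem lemma3p20 (R : realType) (M : closed_surface R) (h : metric M)
  (S : spin_structure h) (c : chart R M) (lambda kappa : R) (q : nat)
  (psi : 'I_q -> M -> 'cV[R[i]]_2)
  (c_isothermal : isothermal h c)
  (psi_smooth : forall i : 'I_q, smooth_spinor S (psi i))
  (psi_dirac : forall (i : 'I_q) (p : M),
     dirac_operator S (psi i) p =
       lambda%:C *: psi i p
       + (kappa%:C * \sum_(j < q) hdot (psi j p) (psi j p)) *: psi i p)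
  (psi_chiral : forall (i m : 'I_q) (p : M),
     \sum_(j < q) hdot (proj_neg S p (psi j p)) (proj_neg S p (psi j p))
                  * hdot (proj_neg S p (psi i p)) (proj_neg S p (psi m p)) =
     \sum_(j < q) hdot (proj_pos S p (psi j p)) (proj_pos S p (psi j p))
                  * hdot (proj_pos S p (psi i p)) (proj_pos S p (psi m p))) :
  let J := noether_current S c psi in
  forall (i m : 'I_q) (p : M), chart_dom c p ->
    coord_diff c 0 (J i m 1) p - coord_diff c 1 (J i m 0) p
    - kappa%:C * \sum_(j < q) (J i j 0 p * J j m 1 p - J i j 1 p * J j m 0 p)
    = 2 * lambda%:C
      * hdot (psi i p) (clifford S p (coord_vector c 0 p)
                         (clifford S p (coord_vector c 1 p) (psi m p))).
Proof.
move=> J i m p cp; have sc := c_isothermal.1.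
have ap := frame_at_dom S p; set a := frame_at S p in ap.
pose v k := coord_vector c k p; pose e k := oframe S k p.
pose u k l := inner h p (v k) (frame a l p).
pose A j := psi j p 0 0; pose B j := psi j p 1 0.
pose PA := \sum_j A j * conjc (A j); pose PB := \sum_j B j * conjc (B j).
pose det := u 0 0 * u 1 1 - u 0 1 * u 1 0.
(* At [p] the nonlinear equation is a linear one with the real coefficient [mu], because the squared
   norm of the spinors is real; the curl computation uses that [mu] equals its conjugate. *)
have [mu muE] : exists mu : R, lambda%:C + kappa%:C * (PA + PB) = mu%:C.
  have nE z : z * conjc z = (complex.Re z ^+ 2 + complex.Im z ^+ 2)%:C :> R[i].
    by case: z => x y; simpc; congr (_ +i* _); ring.
  exists (lambda + kappa *
    (\sum_j (complex.Re (A j) ^+ 2 + complex.Im (A j) ^+ 2) +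
     \sum_j (complex.Re (B j) ^+ 2 + complex.Im (B j) ^+ 2))).
  rewrite !(rmorphD, rmorphM) /= !rmorph_sum /=.
  by congr (_ + _ * (_ + _)); apply: eq_bigr => j _; exact: nE.
have dirac j : dirac_operator S (psi j) p = mu%:C *: psi j p.
  rewrite psi_dirac -scalerDl -muE; congr ((_ + _ * _) *: _).
  by rewrite -big_split; apply: eq_bigr => k _; exact: hdotE.
have chiral : PB * (B i * conjc (B m)) = PA * (A i * conjc (A m)).
  rewrite /PA /PB !mulr_suml.
  apply: (etrans _ (etrans (psi_chiral i m p) _)); apply: eq_bigr => j _.
    by apply/esym; apply: (congr2 *%R); exact: hdot_proj_neg.
  by apply: (congr2 *%R); exact: hdot_proj_pos.
have [_ [rho orth]] := c_isothermal.
have vv : u 0 0 * u 1 0 + u 0 1 * u 1 1 = 0.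
  have := (orth p cp).2 0 1; rewrite mulr0 (inner_frame _ _ ap).
  by rewrite ![inner h p (frame a _ p) _]inner_sym.
have JE j l k : J j l k p = - (u k 0 +i* u k 1) * (A j * conjc (B l)) +
    conjc (u k 0 +i* u k 1) * (B j * conjc (A l)).
  have sE j' : spinor_in_frame a (psi j') p = psi j' p.
    exact: spinor_in_frame_at.
  by apply: (etrans (noether_current_in_frame c psi j l k ap)); rewrite /= !sE.
pose x0 := @chart_point R M p.
pose t k := 2^-1 * connection_form a p (e k).
pose d j l k := cderive (e k) (spinor_near S (psi j) p l) x0.
pose Dw k l := cderive (v k) (coord_frame_coord a c p l) x0.
(* Derivatives along the coordinate vectors are expanded in the frame, where the Dirac equation can
   be substituted. *)
have vE k : v k = u k 0 *: e 0 + u k 1 *: e 1 by exact: frame_expansion.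
have dE j l k : cderive (v k) (spinor_near S (psi j) p l) x0 =
    dir_sum (u k 0) (u k 1) (d j l 0) (d j l 1).
  rewrite [in LHS]vE.
  exact/cderive_dir/spinor_near_cdifferentiable/psi_smooth.
have coordJ k l : coord_diff c k (J i m l) p =
    current_variation (A i) (B i) (A m) (B m) (u l 0 +i* u l 1) (Dw k l)
      (dir_sum (u k 0) (u k 1) (d i 0 0) (d i 0 1))
      (dir_sum (u k 0) (u k 1) (d i 1 0) (d i 1 1))
      (dir_sum (u k 0) (u k 1) (d m 0 0) (d m 0 1))
      (dir_sum (u k 0) (u k 1) (d m 1 0) (d m 1 1)).
  apply: (etrans (coord_diff_noether sc psi_smooth i m l k cp)).
  apply: (etrans (noether_near_cderive sc psi_smooth i m l (v k) cp)).
  exact: (f_equal4 (current_variation (A i) (B i) (A m) (B m) _ (Dw k l))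
    (dE i 0 k) (dE i 1 k) (dE m 0 k) (dE m 1 k)).
(* The factors 2 undo the halves that the spin connection puts into [t]. *)
have thE k : connection_form a p (v k) = u k 0 * (2 * t 0) + u k 1 * (2 * t 1).
  rewrite [in LHS]vE connection_form_lin// /t.
  move: (connection_form _ _ _) (connection_form _ _ _) => th0 th1.
  by field.
have torsion : Dw 0 1 - Dw 1 0 =
    - 'i * ((u 1 0 +i* u 1 1) * (u 0 0 * (2 * t 0) + u 0 1 * (2 * t 1))%:C -
            (u 0 0 +i* u 0 1) * (u 1 0 * (2 * t 0) + u 1 1 * (2 * t 1))%:C).
  apply: (etrans (coord_frame_coord_torsion sc cp ap)).
  exact: (congr2 (fun x y => - 'i * (_ * x%:C - _ * y%:C)) (thE 0) (thE 1)).
have [hi0 hi1] := dirac_solved (dirac i).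
have [hm0 hm1] := dirac_solved (dirac m).
have curl := etrans (congr2 (fun x y => x - y) (coordJ 0 1) (coordJ 1 0))
  (current_curl torsion hi0 hi1 hm0 hm1).
have products : \sum_(j < q) (J i j 0 p * J j m 1 p - J i j 1 p * J j m 0 p) =
    2 * ('i * det%:C) * (PB * (A i * conjc (A m)) - PA * (B i * conjc (B m))).
  rewrite /PA /PB !mulr_suml -sumrB mulr_sumr; apply: eq_bigr => j _.
  apply: etrans (current_commutator _ _ _ _ _ _ _ _ _ _).
  apply: (congr2 (fun x y => x - y)).
    exact: (congr2 *%R (JE i j 0) (JE j m 1)).
  exact: (congr2 *%R (JE i j 1) (JE j m 0)).
have rhs : hdot (psi i p) (clifford S p (v 0) (clifford S p (v 1) (psi m p))) =
    'i * det%:C * (A i * conjc (A m) - B i * conjc (B m)).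
  apply: (etrans (hdotE _ _)); apply: etrans (orthogonal_product _ _ _ _ vv).
  have [e0 e1] := cliffordE S p (v 1) (psi m p).
  have [E0 E1] := cliffordE S p (v 0) (clifford S p (v 1) (psi m p)).
  exact: (congr2 (fun x y => A i * conjc x + B i * conjc y)
    (etrans E0 (congr1 (fun z => - conjc _ * z) e1))
    (etrans E1 (congr1 (fun z => _ * z) e0))).
(* With [X], [Y] the products of positive and of negative components, the commutator leaves of the
   [k] term only [2 * k * z * (PA' * X - PB' * Y)], which chirality makes zero. *)
have arith (l k z X Y PA' PB' : R[i]) : PB' * Y = PA' * X ->
    2 * (l + k * (PA' + PB')) * (z * (X - Y)) - k * (2 * z * (PB' * X - PA' * Y)) =
    2 * l * (z * (X - Y)).
  by move=> ch; ring: ch.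
by rewrite curl products [in RHS]rhs -muE; exact: arith.
Qed.
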